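(* Let $n\ge 1$, let $\lambda$ be an $n$-partition and let $\pi\in S_n^\lambda$. Then the Demazure polynomial (key polynomial) $d_\lambda(\pi;x)$ equals the sum of the weight monomials $x^T$ over all $T\in\mathcal{T}_\lambda$ satisfying condition (i), and it likewise equals the sum of $x^T$ over all $T\in\mathcal{T}_\lambda$ satisfying condition (ii), where (i) $T(l,k)\in A_\lambda(T,\pi;l,k)$ for all $(l,k)\in\lambda$; (ii) $T(l,k)\in B_\lambda(T,\pi;l,k)$ for all $(l,k)\in\lambda$.
   Context: Notation. Fix $n\ge 1$. For integers $p,q$, $[p,q]=\{p,p+1,\dots,q\}$ (empty if $p>q$). An $n$-partition is $\lambda=(\lambda_1\ge\dots\ge\lambda_n\ge 0)$, integers. Its shape has $\lambda_i$ left-justified boxes in row $i$ (row 1 at the top). The box in column $j$ and row $i$ is written $(j,i)\in\lambda$ (column index first). The column lengths are $\zeta_1,\dots,\zeta_{\lambda_1}$. A semistandard tableau $T$ of shape $\lambda$ is a filling with values $T(j,i)\in[1,n]$ such that $T(j,i)\le T(j+1,i)$ and $T(j,i)<T(j,i+1)$; $\mathcal{T}_\lambda$ is the set of these. Boundary conventions: $T(l-1,k):=k$ if $l=1$; $T(l+1,k):=n$ if $l=\lambda_k$; $T(l,k+1):=n+1$ if $k=\zeta_l$. $m(T)$ is the maximum of the values at the bottoms of the columns of $T$ (equivalently the maximum value of $T$); for the empty tableau, $m:=1$. The weight monomial of $T$ is $x^T:=\prod_{i=1}^n x_i^{c_i}$, where $c_i$ is the number of values of $T$ equal to $i$. Permutations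 and keys. $S_n$ is the set of $n$-tuples $\pi=(\pi_1,\dots,\pi_n)$ with distinct entries from $[1,n]$. Let $q_1<\dots<q_r$ be the distinct column lengths of $\lambda$, $q_0:=0$, $q_{r+1}:=n$. $S_n^\lambda$ is the set of $\pi\in S_n$ such that $\pi_i<\pi_j$ whenever $i<j$ both lie in $[q_{s-1}+1,q_s]$ for some $1\le s\le r+1$. The $\lambda$-key $Y_\lambda(\pi)$ is the tableau of shape $\lambda$ whose $j$th column consists of $\pi_1,\dots,\pi_{\zeta_j}$ sorted increasingly from top to bottom; write $Y_\lambda(\pi;j,i)$ or $Y(j,i)$ for its entries. Demazure polynomial. For $1\le i\le n-1$, $s_i.\pi$ is obtained from $\pi\in S_n$ by interchanging the values $i$ and $i+1$ wherever they appear. A reduced composition for $\pi$ is a sequence $s_{i_t}\cdots s_{i_1}$ with $t\ge 0$ minimal such that $s_{i_t}.(\cdots(s_{i_1}.(1,2,\dots,n))\cdots)=\pi$. On polynomials in $x_1,\dots,x_n$, $s_i$ interchanges $x_i$ and $x_{i+1}$, and $\rho_i.P:=\dfrac{x_iP-s_i.(x_iP)}{x_i-x_{i+1}}$. For a reduced composition $s_{i_t}\cdots s_{i_1}$ for $\pi$, $d_\lambda(\pi;x):=\rho_{i_t}\cdots\rho_{i_1}.x_1^{\lambda_1}x_2^{\lambda_2}\cdots x_n^{\lambda_n}$ (independent of the choice of reduced composition). Scanning paths. The earliest weakly increasing subsequence (EWIS) of a sequence $(x_1,x_2,\dots)$ is $(x_{i_1},x_{i_2},\dots)$ with $i_1=1$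 and, for $j>1$, $i_j$ minimal with $i_j>i_{j-1}$ and $x_{i_{j-1}}\le x_{i_j}$. For $T\in\mathcal{T}_\lambda$ and $1\le l\le\lambda_1$, let $T^{(l,\zeta_l)}$ be $T$ with its first $l-1$ columns removed (column indexing retained). For $k=\zeta_l,\zeta_l-1,\dots,1$: read the bottom values of the nonempty columns of $T^{(l,k)}$ from left to right (starting with column $l$, whose bottom is at $(l,k)$), take the EWIS of this sequence, and let the scanning path $P(T;l,k)$ be the sequence of locations of this EWIS; then let $T^{(l,k-1)}$ be the (semistandard) tableau obtained from $T^{(l,k)}$ by removing the boxes of $P(T;l,k)$. Let $U^{(l,k)}$ be $T^{(l,k)}$ with its leftmost remaining column (column $l$) removed. The sets $A$. Write $U=U^{(l,k)}$ and $Y=Y_\lambda(\pi)$. If $m(U)>Y(l,k)$, then $A_\lambda(T,\pi;l,k):=\emptyset$. If $m(U)\le Y(l,k)$, then $A_\lambda(T,\pi;l,k):=[k,\min\{Y(l,k),\,T(l,k+1)-1,\,T(l+1,k)\}]$. The sets $B$. For $(l,k)\in\lambda$ and $j\le l$ there is exactly one $i\in[1,\zeta_j]$ with $(l,k)\in P(T;j,i)$. For $1\le j\le l-1$: let $a(j)$ be the row index with $(l-1,k)\in P(T;j,a(j))$; if $k<\zeta_l$ let $b(j)$ be the row index with $(l,k+1)\in P(T;j,b(j))$, and if $k=\zeta_l$ let $b(j):=\zeta_j+1$. For $a(j)\le i\le b(j)-1$, let $h$ be the largest index less than $l$ such that $(h,r)\in P(T;j,i)$ for some $r$, and set $E(l,k;j,i):=T(h,r)$.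 For $j=l$ set $a(l):=b(l)-1:=k$ and $E(l,k;l,k):=k$. Then $$B_\lambda(T,\pi;l,k):=\bigcap_{j=1}^{l}\Big(\bigcup_{i=a(j)}^{b(j)-1}[E(l,k;j,i),\,Y_\lambda(\pi;j,i)]\Big).$$ *)

(* Defs.v *)
From HB Require Import structures.
From mathcomp Require Import all_boot all_order all_fingroup all_algebra.
From mathcomp Require Import mpoly.

Set Implicit Arguments.
Unset Strict Implicit.
Unset Printing Implicit Defensive.

Import GRing.Theory.

(* Columns, rows and tableau values are 1-based naturals; a box is a pair
   (column, row).  Indices of variables and of 'S_n are 0-based ordinals. *)

Definition itv (p q : nat) : seq nat := index_iota p q.+1.

Definition is_partition n (lam : n.-tuple nat) : Prop := sorted geq lam.

Definition rowlen (lam : seq nat) (i : nat) : nat := nth 0 lam i.-1.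

Definition collen (lam : seq nat) (j : nat) : nat := count (leq j) lam.

(* Listed column by column, left to right, each column top to bottom. *)
Definition cells (lam : seq nat) : seq (nat * nat) :=
  [seq (j, i) | j <- itv 1 (rowlen lam 1), i <- itv 1 (collen lam j)].

Definition filling n (lam : seq nat) := {ffun seq_sub (cells lam) -> 'I_n}.

(* Meaningful only for boxes of the shape; the value is 0 elsewhere. *)
Definition entry n (lam : seq nat) (T : filling n lam) (c : nat * nat) : nat :=
  if insub c is Some c' then (T c').+1 else 0.

Definition semistandard n (lam : seq nat) (T : filling n lam) : bool :=
  all (fun c =>
         (((c.1.+1, c.2) \in cells lam) ==>
            (entry T c <= entry T (c.1.+1, c.2))) &&
         (((c.1, c.2.+1) \in cells lam) ==>
            (entry T c < entry T (c.1, c.2.+1))))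
      (cells lam).

Definition weight n (lam : seq nat) (T : filling n lam) : {mpoly int[n]} :=
  (\prod_(i < n) 'X_i ^+ #|[set c | T c == i]|)%R.

Definition one_line n (pi : 'S_n) : seq nat :=
  [seq (pi i).+1 | i <- enum 'I_n].

Definition pval n (pi : 'S_n) (i : nat) : nat := nth 0 (one_line pi) i.-1.

Definition distinct_collens (lam : seq nat) : seq nat :=
  sort leq (undup [seq collen lam j | j <- itv 1 (rowlen lam 1)]).

(* The sequence q_0 = 0 < q_1 < ... < q_r <= q_(r+1) = n. *)
Definition qseq (n : nat) (lam : seq nat) : seq nat :=
  0 :: rcons (distinct_collens lam) n.

Definition in_Sn_lam n (lam : seq nat) (pi : 'S_n) : Prop :=
  let q := nth 0 (qseq n lam) in
  forall s i j : nat,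
    0 < s <= (size (distinct_collens lam)).+1 ->
    i \in itv (q s.-1).+1 (q s) -> j \in itv (q s.-1).+1 (q s) ->
    i < j -> pval pi i < pval pi j.

Definition key n (lam : seq nat) (pi : 'S_n) (c : nat * nat) : nat :=
  nth 0 (sort leq (take (collen lam c.1) (one_line pi))) c.2.-1.

(* An index i : 'I_n.-1 stands for s_(i+1), which
   interchanges lo i and hi i. *)

Lemma lo_subproof n (i : 'I_n.-1) : i < n.
Proof. exact: leq_trans (ltn_ord i) (leq_pred n). Qed.

Lemma hi_subproof n (i : 'I_n.-1) : i.+1 < n.
Proof. by rewrite -ltn_predRL ltn_ord. Qed.

Definition lo n (i : 'I_n.-1) : 'I_n := Ordinal (lo_subproof i).
Definition hi n (i : 'I_n.-1) : 'I_n := Ordinal (hi_subproof i).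

Definition stransp n (i : 'I_n.-1) : 'S_n := tperm (lo i) (hi i).

(* The product of 'S_n composes from left to right, so the transposition acts
   on the values of pi. *)
Definition sact n (i : 'I_n.-1) (pi : 'S_n) : 'S_n := (pi * stransp i)%g.

(* The composition s_(i_t) ... s_(i_1) is encoded as [:: i_t; ...; i_1]. *)
Definition word_act n (w : seq 'I_n.-1) : 'S_n := foldr (@sact n) 1%g w.

Definition reduced_composition n (pi : 'S_n) (w : seq 'I_n.-1) : Prop :=
  word_act w = pi /\
  forall w' : seq 'I_n.-1, word_act w' = pi -> size w <= size w'.

Lemma rho_exists n (i : 'I_n.-1) (P : {mpoly int[n]}) :
  exists Q : {mpoly int[n]},
    (('X_(lo i) - 'X_(hi i)) * Q ==
     'X_(lo i) * P - msym (stransp i) ('X_(lo i) * P))%R.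
Proof.
set D : {mpoly int[n]} := ('X_(lo i) - 'X_(hi i))%R.
set s := stransp i.
pose dv (R : {mpoly int[n]}) := (exists Q, D * Q = R - msym s R)%R.
have dvM R S : dv R -> dv S -> dv (R * S)%R.
  move=> [Q1 e1] [Q2 e2]; exists (Q1 * S + msym s R * Q2)%R.
  rewrite mulrDr mulrA e1 mulrCA e2 msymM mulrBl mulrBr.
  by rewrite addrA subrK.
have dvX1 k : dv 'X_k.
  have e : msym s 'X_k = 'X_(s k) :> {mpoly int[n]}.
    rewrite msymX; congr ('X_[_]); apply/mnmP => j.
    by rewrite mnmE !mnm1E -(inj_eq (@perm_inj _ s)) permKV.
  rewrite /dv e /s /stransp; case: tpermP => [->|->|_ _].
  - by exists 1%R; rewrite mulr1.
  - by exists (-1)%R; rewrite mulrN1 opprB.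
  - by exists 0%R; rewrite mulr0 subrr.
have dv1 : dv 1%R by exists 0%R; rewrite mulr0 msym1 subrr.
have dvX m : dv 'X_[m].
  rewrite mpolyXE_id; apply: (big_ind dv) => // k _.
  by elim: (m k) => [|d IH]; rewrite ?expr0 // exprS; apply: dvM.
have dvP R : dv R.
  elim/mpolyind: R => [|c m p _ _ [Q2 e2]].
    by exists 0%R; rewrite mulr0 msym0 subrr.
  have [Q1 e1] := dvX m; exists (c *: Q1 + Q2)%R.
  rewrite mulrDr -scalerAr e1 e2 msymD msymZ scalerBr opprD.
  by rewrite -!addrA; congr (_ + _)%R; rewrite addrCA.
by have [Q e] := dvP ('X_(lo i) * P)%R; exists Q; apply/eqP.
Qed.

(* The exact quotient, unique since {mpoly int[n]} is an integral domain. *)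
Definition rho n (i : 'I_n.-1) (P : {mpoly int[n]}) : {mpoly int[n]} :=
  xchoose (rho_exists i P).

Lemma rhoE n (i : 'I_n.-1) (P : {mpoly int[n]}) :
  (('X_(lo i) - 'X_(hi i)) * rho i P =
   'X_(lo i) * P - msym (stransp i) ('X_(lo i) * P))%R.
Proof. exact/eqP/(xchooseP (rho_exists i P)). Qed.

(* This is d_lam(pi; x) when w is a reduced composition for pi; statements
   should hold for every such w, and one exists by the lemma below. *)
Definition demazure n (lam : n.-tuple nat) (w : seq 'I_n.-1) :
    {mpoly int[n]} :=
  foldr (@rho n) (\prod_(i < n) 'X_i ^+ tnth lam i)%R w.

Lemma reduced_composition_exists n (pi : 'S_n) :
  exists w : seq 'I_n.-1, reduced_composition pi w.
Proof.
pose R (g : 'S_n) := exists w : seq 'I_n.-1, word_act w = g.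
pose G (g : 'S_n) := forall h, R h -> R (h * g)%g.
have R1 : R 1%g by exists [::].
have GM g h : G g -> G h -> G (g * h)%g.
  by move=> Gg Gh k Rk; rewrite mulgA; apply/Gh/Gg.
have Gs i : G (stransp i) by move=> h [w <-]; exists (i :: w).
have Gd d : forall x y : 'I_n, y = x + d :> nat -> G (tperm x y).
  elim: d => [|d IH] x y e.
    have -> : x = y by apply/val_inj; rewrite /= e addn0.
    by rewrite tperm1 => h; rewrite mulg1.
  have lt_xd : x + d < n.-1 by rewrite ltn_predRL -addnS -e.
  pose i := Ordinal lt_xd.
  have ey : y = hi i by apply/val_inj; rewrite /= e addnS.
  have [d0|d_gt0] := posnP d.
    have -> : x = lo i by apply/val_inj; rewrite /= d0 addn0.
    by rewrite ey; apply: Gs.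
  have nx : lo i != x by rewrite -val_eqE /= -[X in _ != X]addn0 eqn_add2l -lt0n.
  have nxh : hi i != x.
    by rewrite -ey -val_eqE /= e -[X in _ != X]addn0 eqn_add2l.
  have -> : tperm x y = (stransp i * (tperm x (lo i) * stransp i))%g.
    have := tpermJ x (lo i) (stransp i).
    rewrite conjgE /stransp tpermV tpermL tpermD // => ->.
    by rewrite ey.
  by apply: (GM _ _ (Gs i)); apply: (GM _ _ (IH _ _ _) (Gs i)).
have Gt x y : G (tperm x y).
  wlog le_xy : x y / x <= y.
    move=> H; case/orP: (leq_total x y) => /H //.
    by rewrite tpermC.
  by apply: (Gd (y - x)); rewrite subnKC.
have Rp : R pi.
  have [ts -> _] := prod_tpermP pi.
  rewrite -[X in R X]mul1g; apply: (_ : G _) => //.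
  by apply: (big_ind G) => // h; rewrite mulg1.
have exP : exists k, [exists t : k.-tuple 'I_n.-1, word_act t == pi].
  by have [w e] := Rp; exists (size w); apply/existsP; exists (in_tuple w); apply/eqP.
have [k /existsP[t /eqP e] kmin] := ex_minnP exP.
exists t; split=> // w' e'; rewrite size_tuple; apply: kmin.
by apply/existsP; exists (in_tuple w'); apply/eqP.
Qed.

Fixpoint ewis_from (T : nat * nat -> nat) (m : nat) (s : seq (nat * nat)) :=
  if s is c :: s' then
    if m <= T c then c :: ewis_from T (T c) s' else ewis_from T m s'
  else [::].

(* Locations, in the sequence s of boxes, of the earliest weakly increasing
   subsequence of the values of T. *)
Definition ewis (T : nat * nat -> nat) (s : seq (nat * nat)) :=
  if s is c :: s' then c :: ewis_from T (T c) s' else [::].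

(* A subtableau is given by its boxes, listed as in [cells]; the bottoms of its
   nonempty columns then come from left to right. *)
Definition bottoms (D : seq (nat * nat)) : seq (nat * nat) :=
  [seq c <- D | (c.1, c.2.+1) \notin D].

(* The boxes of T^(l, zeta_l - d). *)
Fixpoint scan_boxes (lam : seq nat) (T : nat * nat -> nat) (l d : nat) :
    seq (nat * nat) :=
  if d is d'.+1 then
    let D := scan_boxes lam T l d' in
    [seq c <- D | c \notin ewis T (bottoms D)]
  else [seq c <- cells lam | l <= c.1].

Definition Tboxes (lam : seq nat) (T : nat * nat -> nat) (l k : nat) :=
  scan_boxes lam T l (collen lam l - k).

Definition scan_path (lam : seq nat) (T : nat * nat -> nat) (l k : nat) :
    seq (nat * nat) :=
  ewis T (bottoms (Tboxes lam T l k)).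

Definition Uboxes (lam : seq nat) (T : nat * nat -> nat) (l k : nat) :=
  [seq c <- Tboxes lam T l k | c.1 != l].

Definition max_bottom (T : nat * nat -> nat) (D : seq (nat * nat)) : nat :=
  if D is [::] then 1 else \max_(c <- bottoms D) T c.

Definition T_below n (lam : seq nat) (T : nat * nat -> nat) (l k : nat) : nat :=
  if k == collen lam l then n.+1 else T (l, k.+1).

Definition T_right n (lam : seq nat) (T : nat * nat -> nat) (l k : nat) : nat :=
  if l == rowlen lam k then n else T (l.+1, k).

Definition setA n (lam : seq nat) (T : nat * nat -> nat) (pi : 'S_n)
    (l k : nat) : seq nat :=
  if key lam pi (l, k) < max_bottom T (Uboxes lam T l k) then [::]
  else itv k (minn (key lam pi (l, k))
                (minn (T_below n lam T l k - 1) (T_right n lam T l k))).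

(* The row index i such that the box c lies on P(T; j, i). *)
Definition path_index (lam : seq nat) (T : nat * nat -> nat) (j : nat)
    (c : nat * nat) : nat :=
  head 0 [seq i <- itv 1 (collen lam j) | c \in scan_path lam T j i].

Definition a_index (lam : seq nat) (T : nat * nat -> nat) (l k j : nat) : nat :=
  if j == l then k else path_index lam T j (l.-1, k).

Definition b_index (lam : seq nat) (T : nat * nat -> nat) (l k j : nat) : nat :=
  if j == l then k.+1
  else if k < collen lam l then path_index lam T j (l, k.+1)
  else (collen lam j).+1.

(* Columns increase along a scanning path, so the box of the path with largest
   column index less than l is the last one to the left of column l. *)
Definition Eval (lam : seq nat) (T : nat * nat -> nat) (l k j i : nat) : nat :=
  if j == l then k
  else T (last (0, 0) [seq c <- scan_path lam T j i | c.1 < l]).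

Definition setB n (lam : seq nat) (T : nat * nat -> nat) (pi : 'S_n)
    (l k : nat) : pred nat :=
  fun v => all (fun j =>
      has (fun i => v \in itv (Eval lam T l k j i) (key lam pi (j, i)))
        (itv (a_index lam T l k j) (b_index lam T l k j - 1)))
    (itv 1 l).

Definition condA n (lam : seq nat) (pi : 'S_n) (T : filling n lam) : bool :=
  all (fun c => entry T c \in setA lam (entry T) pi c.1 c.2) (cells lam).

Definition condB n (lam : seq nat) (pi : 'S_n) (T : filling n lam) : bool :=
  all (fun c => entry T c \in setB lam (entry T) pi c.1 c.2) (cells lam).

(* Main.v *)
Require Import Defs.
From mathcomp Require Import all_boot all_order all_fingroup all_algebra.
From mathcomp Require Import mpoly.
From mathcomp Require Import zify.

Set Implicit Arguments.
Unset Strict Implicit.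
Unset Printing Implicit Defensive.

Import GRing.Theory.

(** Write S(l,k) for the value at the end of the scanning path P(T;l,k).  It is
    the maximum of T^(l,k), and both conditions on T say that S <= Y_lam(pi)
    entrywise.  For condition A this is the description of S as a maximum.  For
    condition B, a box (l,k) lies on exactly one of the paths that start in a
    given column j <= l, say on P(T;j,i0); among the intervals of the union for
    j, those with i > i0 start above T(l,k), because these paths pass over the
    box (l,k), and those with i <= i0 end at or below Y(j,i0).  So B bounds the
    value in every box of P(T;j,i0) by Y(j,i0) ([setAE], [setB_scan],
    [scan_setB]).

    It remains to see that the key polynomial is the generating function of the
    tableaux with S <= Y_lam(pi).  The l-th column of S is obtained by reading
    the columns l, l+1, ... of T one after the other: the set V of the current
    values of the paths is replaced, when the column C is read, by C together
    with the elements of V left over by a greedy matching of V into C.  On the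
    vectors of membership bits, listed from the value n down to 1, this is the
    transducer [slide], whose only memory is a counter ([bits_greedy],
    [Phi_columns]).  Hence the effect of exchanging i and i+1 in a column can be
    decided by looking at two consecutive steps of the transducer.

    Tableaux are grouped into the i-strings of the crystal: the columns that
    contain i+1 but not i are opening brackets, those that contain i but not i+1
    are closing brackets, and the operators change the sign of an unmatched
    column.  Along a string, S stays the same after the second element, and from
    the first to the second element each of its columns is unchanged or has its
    i replaced by i+1 ([Phi_flip]); moreover, no column of S for the first
    element contains i+1 without i ([Phi_minus]).  Therefore, if i precedes i+1
    in pi, a string meets the set of tableaux with S <= Y_lam(pi) in nothing, in
    its first element or in all its elements; in the last two cases it lies in
    the set for s_i.pi, and in the first case it is disjoint from it.  Applied to the weight of the first element, and also
    to that of the whole string, rho_i gives the weight of the whole string, so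
    rho_i turns the sum for pi into that for s_i.pi ([demazure_step]).

    A reduced composition only uses such steps, by the exchange property
    ([reduced_cons]), and for the identity the only tableau is the one with all
    entries k in row k, of weight x^lam ([demazure_id]). *)

(** * Columns as vectors of bits *)

(** A set of values in [1, n] is encoded by its membership bits, listed from
    the value n down to the value 1; dropping k bits keeps the values that are
    at most n - k. *)
Definition suffix_count (k : nat) (C : seq bool) : nat := count id (drop k C).

(** The entrywise order on columns, V <= C, in terms of the numbers of values
    below each bound.  V may be longer than C, as for adjacent columns of a
    tableau. *)
Definition dom (V C : seq bool) : bool :=
  all (fun k => suffix_count k C <= suffix_count k V) (iota 0 (size C)).

(** V holds the current values of the scanning paths and C is the next column.
    From large to small, a value v of V takes the largest entry of C that is
    still free, provided it is at least v.  The counter d is the number of free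
    entries of C that have been read, so that v stays in place exactly when
    d = 0; the entries of C always belong to the result. *)
Fixpoint slide (d : nat) (V C : seq bool) : seq bool :=
  match V, C with
  | v :: V', c :: C' => (c || v && (d == 0)) :: slide (d + c - v) V' C'
  | _, _ => [::]
  end.

Fixpoint pend (d : nat) (V C : seq bool) : nat :=
  match V, C with
  | v :: V', c :: C' => pend (d + c - v) V' C'
  | _, _ => d
  end.

Lemma slide_cat d P P' Q Q' : size P = size P' ->
  slide d (P ++ Q) (P' ++ Q') = slide d P P' ++ slide (pend d P P') Q Q'.
Proof. by elim: P d P' => [|v P IH] d [|c P'] //= [e]; rewrite IH. Qed.

Lemma size_slide d V C : size V = size C -> size (slide d V C) = size C.
Proof. by elim: V d C => [|v V IH] d [|c C] //= [e]; rewrite IH. Qed.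

Lemma domP V C : size V = size C ->
  reflect (forall k, suffix_count k C <= suffix_count k V) (dom V C).
Proof.
move=> e; apply: (iffP allP) => [H k|H k _]; last exact: H.
have [lt_k|le_k] := ltnP k (size C); first by apply: H; rewrite mem_iota.
by rewrite /suffix_count drop_oversize.
Qed.

(** The values at the ends of the scanning paths that start in the first
    column, as a set. *)
Definition Phi (cs : seq (seq bool)) : seq bool :=
  if cs is C :: s then foldl (slide 0) C s else [::].

Definition bit_count (k : nat) (cs : seq (seq bool)) : nat :=
  count (fun C => nth false C k) cs.

(** * Exchanging two adjacent values *)

Section Strings.
Variable r : nat.
Implicit Types (C V W P Q : seq bool) (cs : seq (seq bool)).

(** Position r is that of a value i+1, and position r+1 that of i. *)
Definition hi_bit C := nth false C r.
Definition lo_bit C := nth false C r.+1.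
Definition plus C := ~~ hi_bit C && lo_bit C.
Definition minus C := hi_bit C && ~~ lo_bit C.
Definition sw C := take r C ++ lo_bit C :: hi_bit C :: drop r.+2 C.

Lemma hi_bit_cat P x y Q : size P = r -> hi_bit (P ++ x :: y :: Q) = x.
Proof. by move=> e; rewrite /hi_bit nth_cat e ltnn subnn. Qed.

Lemma lo_bit_cat P x y Q : size P = r -> lo_bit (P ++ x :: y :: Q) = y.
Proof. by move=> e; rewrite /lo_bit nth_cat e ltnNge leqnSn /= subSnn. Qed.

Lemma sw_cat P x y Q : size P = r -> sw (P ++ x :: y :: Q) = P ++ y :: x :: Q.
Proof.
move=> e; rewrite /sw hi_bit_cat // lo_bit_cat //.
by rewrite -e take_size_cat // drop_cat ltnNge leqW // -addn2 addKn /= drop0.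
Qed.

Lemma splitE C : r.+1 < size C ->
  exists P x y Q, [/\ size P = r, C = P ++ x :: y :: Q & size C = r + (size Q).+2].
Proof.
move=> h; exists (take r C), (hi_bit C), (lo_bit C), (drop r.+2 C).
have hr : r < size C by apply: ltnW.
have eP : size (take r C) = r by rewrite size_take hr.
have e : C = take r C ++ hi_bit C :: lo_bit C :: drop r.+2 C.
  by rewrite -{1}(cat_take_drop r C) (drop_nth false) // (drop_nth false h).
by split=> //; rewrite {1}e size_cat eP.
Qed.

(** How a column of S changes from one element of an i-string to the next. *)
Definition sw_rel V W := V = W \/ plus V /\ W = sw V.

Lemma sw_size C : r.+1 < size C -> size (sw C) = size C.
Proof.
by move=> /splitE[P [x [y [Q [e -> _]]]]]; rewrite sw_cat // !size_cat.
Qed.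

Lemma swK C : r.+1 < size C -> sw (sw C) = C.
Proof. by move=> /splitE[P [x [y [Q [e -> _]]]]]; rewrite !sw_cat. Qed.

Lemma plus_sw C : r.+1 < size C -> plus (sw C) = minus C.
Proof.
move=> /splitE[P [x [y [Q [e -> _]]]]].
by rewrite sw_cat // /plus /minus !hi_bit_cat // !lo_bit_cat // andbC.
Qed.

Lemma minus_sw C : r.+1 < size C -> minus (sw C) = plus C.
Proof. by move=> h; rewrite -plus_sw ?swK ?sw_size. Qed.

Lemma count_sw C : r.+1 < size C -> count id (sw C) = count id C.
Proof.
by move=> /splitE[P [x [y [Q [e -> _]]]]]; rewrite sw_cat // !count_cat /=; lia.
Qed.

Lemma plusN C : plus C -> ~~ minus C.
Proof. by rewrite /plus /minus; case: (hi_bit C). Qed.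

Ltac split2 V C hV hC e :=
  case: (splitE hV) e => [P [x [y [Q [eP -> ->]]]]];
  case: (splitE hC) => [P' [x' [y' [Q' [eP' -> ->]]]]] /addnI[e].

(** If i+1 is in the result without being in C, it stays in place from V with
    counter 0; then i, which V also contains, stays in place too. *)
Lemma slide_minus V C : r.+1 < size V -> size V = size C ->
  ~~ minus V -> ~~ minus C -> ~~ minus (slide 0 V C).
Proof.
move=> hV e; have hC : r.+1 < size C by rewrite -e.
split2 V C hV hC e.
rewrite slide_cat ?eP ?eP' // /minus !hi_bit_cat ?lo_bit_cat ?size_slide ?eP' ?eP //=.
set d := pend _ _ _; clearbody d.
by case: x x' y y' => [] [] [] [] //=; case: d => [|[|d]].
Qed.

(** C offers one entry at i or at i+1, so the counter is the same after these
    two steps, and only the two bits can differ.  They agree when V contains both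
    values and the counter is 0: then both values are in both results. *)
Lemma slide_sw V C : r.+1 < size V -> size V = size C ->
  ~~ minus V -> plus C -> sw_rel (slide 0 V C) (slide 0 V (sw C)).
Proof.
move=> hV e; have hC : r.+1 < size C by rewrite -e.
split2 V C hV hC e.
rewrite sw_cat // /minus /plus !hi_bit_cat // !lo_bit_cat //.
rewrite !slide_cat ?eP ?eP' //=.
set d := pend _ _ _; clearbody d.
have eL : size (slide 0 P P') = r by rewrite size_slide ?eP'.
case: x' y' => [] [] //; case: x y => [] [] //= _ _.
- case: d => [|d]; [by left|right; rewrite /plus hi_bit_cat // lo_bit_cat //].
  by rewrite sw_cat //= !(addn0, addn1, subn1, subn0).
- rewrite !addn0 !addn1 !subn0 !subn1 /=.
  by right; rewrite /plus hi_bit_cat // lo_bit_cat // sw_cat //.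
- right; rewrite /plus hi_bit_cat // lo_bit_cat // sw_cat //=.
  by rewrite !(addn0, addn1, subn0, subn1).
Qed.

(** If C contains neither value, a path at i and a path at i+1 behave in the
    same way: they take the same larger entry or stay in place.  If C contains
    i+1, the results are equal. *)
Lemma slide_rel V W C : r.+1 < size V -> size V = size C ->
  sw_rel V W -> ~~ plus C -> sw_rel (slide 0 V C) (slide 0 W C).
Proof.
move=> hV e [->|[]]; first by left.
have hC : r.+1 < size C by rewrite -e.
split2 V C hV hC e.
move=> pV ->; move: pV.
rewrite sw_cat // /minus /plus !hi_bit_cat // !lo_bit_cat //.
rewrite !slide_cat ?eP ?eP' //=.
set d := pend _ _ _; clearbody d.
have eL : size (slide 0 P P') = r by rewrite size_slide ?eP'.
case: x' y' => [] [] //; case: x y => [] [] //= _ _.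
- by left; case: d => [|d] /=; rewrite !(addn0, addn1, subn0, subn1).
- by left; case: d => [|d] /=; rewrite !(addn0, addn1, subn0, subn1).
- rewrite !(addn0, addn1, subn0, subn1) /=; case: d => [|d] /=; last by left.
  by right; rewrite /plus hi_bit_cat // lo_bit_cat // sw_cat.
Qed.

(** As i+1 is free when it is reached, a path at i and a path at i+1 move to
    the same entry of C, and nothing remains of the difference. *)
Lemma slide_rel_eq V W C : r.+1 < size V -> size V = size C ->
  sw_rel V W -> hi_bit C -> slide 0 V C = slide 0 W C.
Proof.
move=> hV e [->|[]] //.
have hC : r.+1 < size C by rewrite -e.
split2 V C hV hC e.
move=> pV ->; move: pV.
rewrite sw_cat // /minus /plus !hi_bit_cat // !lo_bit_cat //.
rewrite !slide_cat ?eP ?eP' //=.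
set d := pend _ _ _; clearbody d.
by case: x' y' => [] [] //; case: x y => [] [] //= _ _;
  case: d => [|d] /=; rewrite !(addn0, addn1, subn0, subn1).
Qed.

Lemma suffix_count_catl P Q k : k <= size P ->
  suffix_count k (P ++ Q) = suffix_count k P + count id Q.
Proof.
rewrite /suffix_count drop_cat leq_eqVlt => /orP[/eqP->|->].
  by rewrite ltnn subnn drop_size drop0.
by rewrite count_cat.
Qed.

Lemma suffix_count_catr P Q k : size P <= k ->
  suffix_count k (P ++ Q) = suffix_count (k - size P) Q.
Proof. by move=> h; rewrite /suffix_count drop_cat ltnNge h. Qed.

Lemma suffix_count_split P x y Q k : size P = r ->
  suffix_count k (P ++ x :: y :: Q) =
  if k <= r then suffix_count k P + x + y + count id Q
  else if k == r.+1 then y + count id Q else suffix_count (k - r.+2) Q.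
Proof.
move=> e; case: leqP => [h|h]; first by rewrite suffix_count_catl ?e //= !addnA.
rewrite suffix_count_catr ?e ?(ltnW h) //; case: eqP => [->|ne].
  by rewrite subSnn /suffix_count /= ?drop0.
have -> : k - r = (k - r.+2).+2 by lia.
by [].
Qed.

Lemma suffix_count_sw C k : r.+1 < size C -> k != r.+1 ->
  suffix_count k (sw C) = suffix_count k C.
Proof.
move=> /splitE[P [x [y [Q [e -> _]]]]] ne.
rewrite sw_cat // !suffix_count_split // (negbTE ne); case: leqP => // _; lia.
Qed.

Lemma suffix_count_r C : r.+1 < size C ->
  [/\ suffix_count r C = suffix_count r.+2 C + hi_bit C + lo_bit C,
      suffix_count r.+1 C = suffix_count r.+2 C + lo_bit C
    & suffix_count r.+1 (sw C) = suffix_count r.+2 C + hi_bit C].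
Proof.
move=> /splitE[P [x [y [Q [e -> _]]]]].
rewrite sw_cat // !suffix_count_split // hi_bit_cat // lo_bit_cat //.
have h1 : r.+2 <= r = false by lia.
have h2 : r.+2 == r.+1 = false by lia.
rewrite leqnn ltnn eqxx h1 h2.
by rewrite subnn /suffix_count !drop0 -e drop_size /=; split; lia.
Qed.

(** The exchange affects only the number of values that are at most i, so this
    is the only inequality to be checked again. *)
Lemma dom_swP V C V' C' : r.+1 < size V -> size V = size C ->
  V' = V \/ V' = sw V -> C' = C \/ C' = sw C ->
  dom V C -> (suffix_count r.+1 C' <= suffix_count r.+1 V') -> dom V' C'.
Proof.
move=> hV e eV eC /(domP e) H hr.
have hC : r.+1 < size C by rewrite -e.
have e' : size V' = size C'.
  by case: eV eC => -> [] ->; rewrite ?sw_size.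
apply/(domP e') => k; have [->//|ne] := eqVneq k r.+1.
by case: eV eC => -> [] ->; rewrite ?suffix_count_sw.
Qed.

Lemma dom_sw_minus V C : r.+1 < size V -> size V = size C ->
  dom V C -> ~~ minus C -> dom V (sw C).
Proof.
move=> hV e d nC; have hC : r.+1 < size C by rewrite -e.
apply: (dom_swP hV e (or_introl erefl) (or_intror erefl) d).
have [c1 c2 c3] := suffix_count_r hC.
have := (domP e d) r.+1; move: nC; rewrite /minus c2 c3.
by case: (hi_bit C) (lo_bit C) => [] []; lia.
Qed.

Lemma dom_unsw V C : r.+1 < size V -> size V = size C ->
  dom V (sw C) -> ~~ minus V -> dom V C.
Proof.
move=> hV e d nV; have hC : r.+1 < size C by rewrite -e.
have e' : size V = size (sw C) by rewrite sw_size.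
rewrite -{1}(swK hC).
apply: (dom_swP hV e' (or_introl erefl) (or_intror erefl) d); rewrite (swK hC).
have [c1 c2 c3] := suffix_count_r hC; have [v1 v2 v3] := suffix_count_r hV.
have := domP e' d r; have := (domP e' d) r.+1; have := (domP e' d) r.+2.
rewrite (suffix_count_sw hC (k := r)) ?(suffix_count_sw hC (k := r.+2)); try lia.
rewrite c1 c2 c3 v1 v2; move: nV; rewrite /minus.
by case: (hi_bit C) (lo_bit C) (hi_bit V) (lo_bit V) => [] [] [] []; lia.
Qed.

Lemma dom_swl V C : r.+1 < size V -> size V = size C ->
  plus V -> dom V C -> ~~ plus C -> dom (sw V) C.
Proof.
move=> hV e pV d nC; have hC : r.+1 < size C by rewrite -e.
apply: (dom_swP hV e (or_intror erefl) (or_introl erefl) d).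
have [c1 c2 c3] := suffix_count_r hC; have [v1 v2 v3] := suffix_count_r hV.
have := domP e d r; have := (domP e d) r.+1; have := (domP e d) r.+2.
rewrite c1 c2 v1 v2 v3; move: pV nC; rewrite /plus.
by case: (hi_bit C) (lo_bit C) (hi_bit V) (lo_bit V) => [] [] [] []; lia.
Qed.

Lemma dom_unswl V C : r.+1 < size V -> size V = size C ->
  ~~ minus V -> dom (sw V) C -> dom V C.
Proof.
move=> hV e pV d; have hV' : r.+1 < size (sw V) by rewrite sw_size.
have e' : size (sw V) = size C by rewrite sw_size.
rewrite -{1}(swK hV).
apply: (dom_swP hV' e' (or_intror erefl) (or_introl erefl) d); rewrite (swK hV).
have [v1 v2 v3] := suffix_count_r hV.
have := (domP e' d) r.+1.
rewrite v2 v3; move: pV; rewrite /minus.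
by case: (hi_bit V) (lo_bit V) => [] []; lia.
Qed.

(** * Signatures and strings *)

(** Bracketing rule: [minus] columns open, [plus] columns close.  These are the
    numbers of unmatched closing and of unmatched opening brackets; the
    unmatched ones form a sequence of closing brackets followed by opening
    ones. *)
Fixpoint free_plus cs : nat :=
  if cs is C :: s then
    if plus C then (free_plus s).+1
    else if minus C then (free_plus s).-1 else free_plus s
  else 0.

Fixpoint free_minus cs : nat :=
  if cs is C :: s then
    if minus C && (free_plus s == 0) then (free_minus s).+1 else free_minus s
  else 0.

Lemma free_plus_cat X Z :
  free_plus (X ++ Z) = free_plus X + (free_plus Z - free_minus X).
Proof.
elim: X => [|C X IH] /=; first by rewrite subn0.
rewrite IH; case: ifP => [/plusN/negPf->|_] //; case: ifP => //= _.
by case: eqP; lia.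
Qed.

Lemma free_minus_cat X Z :
  free_minus (X ++ Z) = free_minus Z + (free_minus X - free_plus Z).
Proof.
elim: X => [|C X IH] /=; first by rewrite addn0.
rewrite free_plus_cat IH; case: (minus C) => //=.
by case: eqP; case: eqP; lia.
Qed.

Lemma free_minus_drop l cs : free_minus cs = 0 -> free_minus (drop l cs) = 0.
Proof. by rewrite -{1}(cat_take_drop l cs) free_minus_cat; lia. Qed.

(** Matched brackets come in pairs. *)
Lemma count_signs cs :
  count plus cs + free_minus cs = count minus cs + free_plus cs.
Proof.
elim: cs => //= C s IH; case: (boolP (plus C)) => [/plusN/negPf->|_] /=; first by lia.
by case: (minus C) => //=; case: eqP; lia.
Qed.

(** The crystal operators.  The first [plus] column after which no closing
    bracket is unmatched is the last unmatched closing bracket, when there is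
    one; the first such [minus] column is the first unmatched opening bracket.
    These are the columns on which f_i and e_i act. *)
Fixpoint flip (q : pred (seq bool)) cs : seq (seq bool) :=
  if cs is C :: s then
    if q C && (free_plus s == 0) then sw C :: s else C :: flip q s
  else [::].

(** A signed column between X and Z is then unmatched, and an operator acts on
    it. *)
Definition pivot X Z := (free_minus X == 0) && (free_plus Z == 0).

Lemma plus_pivot cs : 0 < free_plus cs ->
  exists X C Z, [/\ cs = X ++ C :: Z, plus C & pivot X Z].
Proof.
elim: cs => //= C s IH h.
have [/andP[pC /eqP us]|] := boolP (plus C && (free_plus s == 0)).
  by exists [::], C, s; rewrite /pivot us pC.
move=> ne.
have hs : (minus C : nat) < free_plus s.
  move: h ne; case: ifP => [/plusN/negPf->|_] /=; first by case: (free_plus s).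
  by case: (minus C); lia.
have [|X [D [Z [e pD /andP[/eqP uX /eqP uZ]]]]] := IH; first by lia.
exists (C :: X), D, Z; rewrite e; split=> //; rewrite /pivot /= uX uZ.
move: hs; rewrite e free_plus_cat /= pD uZ uX; case: (minus C) => //= hs.
by rewrite (_ : free_plus X == 0 = false) //; lia.
Qed.

Lemma minus_pivot cs : 0 < free_minus cs ->
  exists X C Z, [/\ cs = X ++ C :: Z, minus C & pivot X Z].
Proof.
elim: cs => //= C s IH; case: ifP => [/andP[mC /eqP us] _|ne h].
  by exists [::], C, s; rewrite /pivot us mC.
have [X [D [Z [e mD /andP[/eqP uX /eqP uZ]]]]] := IH h.
exists (C :: X), D, Z; rewrite e; split=> //; rewrite /pivot /= uX uZ.
have npD : plus D = false by apply/negP => /plusN; rewrite mD.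
by move: ne; rewrite e free_plus_cat /= npD mD uZ uX addn0 => ->.
Qed.

Lemma flip_plus X C Z : plus C -> pivot X Z ->
  flip plus (X ++ C :: Z) = X ++ sw C :: Z.
Proof.
move=> pC /andP[/eqP uX /eqP uZ]; elim: X uX => /= [_|D X IH h].
  by rewrite pC uZ.
have uX : free_minus X = 0 by move: h; case: ifP.
by rewrite IH // free_plus_cat /= pC uZ uX addnS andbF.
Qed.

Lemma flip_minus X C Z : minus C -> pivot X Z ->
  flip minus (X ++ C :: Z) = X ++ sw C :: Z.
Proof.
move=> mC /andP[/eqP uX /eqP uZ]; elim: X uX => /= [_|D X IH h].
  by rewrite mC uZ.
have npC : plus C = false by apply/negP => /plusN; rewrite mC.
move: h; case: ifP => // ne uX.
by rewrite IH // free_plus_cat /= npC mC uZ uX addn0 ne.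
Qed.

Lemma bit_count_cat k X Z : bit_count k (X ++ Z) = bit_count k X + bit_count k Z.
Proof. exact: count_cat. Qed.

Lemma nth_sw C k : r.+1 < size C -> k != r -> k != r.+1 ->
  nth false (sw C) k = nth false C k.
Proof.
move=> /splitE[P [x [y [Q [e -> _]]]]] h1 h2; rewrite sw_cat // !nth_cat e.
case: ltnP => // h; have -> : k - r = (k - r.+2).+2 by lia.
by [].
Qed.

Lemma sw_bits C : r.+1 < size C ->
  nth false (sw C) r = lo_bit C /\ nth false (sw C) r.+1 = hi_bit C.
Proof.
move=> /splitE[P [x [y [Q [e -> _]]]]]; rewrite sw_cat //.
by rewrite -/(hi_bit _) -/(lo_bit _) !hi_bit_cat // !lo_bit_cat.
Qed.

Lemma bit_count_signs cs :
  bit_count r.+1 cs + free_minus cs = bit_count r cs + free_plus cs.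
Proof.
suff : bit_count r.+1 cs + count minus cs = bit_count r cs + count plus cs.
  by have := count_signs cs; lia.
elim: cs => //= C s; rewrite /bit_count /= -/(hi_bit C) -/(lo_bit C) /plus /minus.
by case: (hi_bit C) (lo_bit C) => [] [] /=; lia.
Qed.

Variable m : nat.
Hypothesis hr : r.+1 < m.

Definition sized cs := all (fun C => size C == m) cs.

Lemma sized_cat X C Z : sized (X ++ C :: Z) = [&& sized X, size C == m & sized Z].
Proof. by rewrite /sized all_cat. Qed.

Lemma size_hr C : size C == m -> r.+1 < size C. Proof. by move=> /eqP->. Qed.

Lemma flip_plusP cs : sized cs -> 0 < free_plus cs ->
  [/\ free_plus (flip plus cs) = (free_plus cs).-1,
      free_minus (flip plus cs) = (free_minus cs).+1
    & flip minus (flip plus cs) = cs].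
Proof.
move=> zc /plus_pivot[X [C [Z [e pC pv]]]]; subst cs.
move: zc; rewrite sized_cat => /and3P[_ /size_hr hC _].
have mC : minus (sw C) by rewrite minus_sw.
have npC : plus (sw C) = false by apply/negP => /plusN; rewrite mC.
rewrite flip_plus // flip_minus // swK //; case/andP: pv => /eqP uX /eqP uZ.
rewrite !free_plus_cat !free_minus_cat /= pC mC npC (negbTE (plusN pC)) uX uZ /=.
by split=> //; lia.
Qed.

Lemma flip_minusP cs : sized cs -> 0 < free_minus cs ->
  [/\ free_plus (flip minus cs) = (free_plus cs).+1,
      free_minus (flip minus cs) = (free_minus cs).-1
    & flip plus (flip minus cs) = cs].
Proof.
move=> zc /minus_pivot[X [C [Z [e mC pv]]]]; subst cs.
move: zc; rewrite sized_cat => /and3P[_ /size_hr hC _].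
have pC : plus (sw C) by rewrite plus_sw.
have npC : plus C = false by apply/negP => /plusN; rewrite mC.
rewrite flip_minus // flip_plus // swK //; case/andP: pv => /eqP uX /eqP uZ.
rewrite !free_plus_cat !free_minus_cat /= pC mC npC (negbTE (plusN pC)) uX uZ /=.
by split=> //; lia.
Qed.

Lemma foldl_size V Z : size V = m -> sized Z -> size (foldl (slide 0) V Z) = m.
Proof.
elim: Z V => //= C Z IH V hV /andP[/eqP hC hZ].
by apply: IH => //; rewrite size_slide ?hV.
Qed.

Lemma size_Phi cs : sized cs -> cs != [::] -> size (Phi cs) = m.
Proof. by case: cs => //= C s /andP[/eqP hC hs] _; apply: foldl_size. Qed.

Lemma slide_lo_bit V C : size V = m -> size C = m -> lo_bit C -> ~~ minus (slide 0 V C).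
Proof.
move=> hV hC; have h : r.+1 < size V by rewrite hV.
have h' : r.+1 < size C by rewrite hC.
case: (splitE h) (splitE h') => [P [x [y [Q [eP eV _]]]]] [P' [x' [y' [Q' [eP' eC _]]]]].
rewrite eV eC slide_cat ?eP ?eP' //= /minus hi_bit_cat ?lo_bit_cat ?size_slide ?eP ?eP' //.
by move=> ->; rewrite andbF.
Qed.

Lemma Phi_rcons cs C : cs != [::] -> Phi (rcons cs C) = slide 0 (Phi cs) C.
Proof. by case: cs => //= D s _; rewrite foldl_rcons. Qed.

(** When every opening bracket is matched, the last column that contains i or
    i+1 contains i, and the later columns cannot create the pattern of i+1
    without i. *)
Lemma Phi_minus cs : sized cs -> free_minus cs = 0 -> ~~ minus (Phi cs).
Proof.
elim/last_ind: cs => [|s C IH]; first by rewrite /minus /hi_bit nth_nil.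
rewrite /sized all_rcons => /andP[hC hs]; rewrite -cats1 free_minus_cat => u0.
have nC : ~~ minus C by apply/negP => mC; move: u0; rewrite /= mC.
case: s IH hs u0 => [|D s] // IH hs u0.
rewrite cats1 Phi_rcons //.
have zPhi : size (Phi (D :: s)) = m by apply: size_Phi.
have [lC|lC] := boolP (lo_bit C); first by apply: slide_lo_bit => //; apply/eqP.
apply: slide_minus; rewrite ?zPhi // ?(eqP hC) //.
apply: IH => //; move: u0; rewrite /= (negbTE nC) /=.
by rewrite /plus (negbTE lC) andbF /= add0n subn0.
Qed.

(** When Z has no unmatched closing bracket, its first column that contains i
    or i+1 contains i+1, and reading that column makes the two states equal.  An
    unmatched opening bracket ensures that there is such a column. *)
Lemma foldl_sw_rel V W Z : size V = m -> sized Z -> free_plus Z = 0 ->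
  sw_rel V W ->
  sw_rel (foldl (slide 0) V Z) (foldl (slide 0) W Z) /\
  (0 < free_minus Z -> foldl (slide 0) V Z = foldl (slide 0) W Z).
Proof.
elim: Z V W => //= C Z IH V W hV /andP[/eqP hC hZ].
case: ifP => // pC uZ sVW.
have h1 : r.+1 < size V by rewrite hV.
have h2 : size V = size C by rewrite hV.
have [mC|mC] := boolP (minus C).
  suff -> : slide 0 V C = slide 0 W C by split=> //; left.
  by apply: slide_rel_eq h1 h2 sVW _; case/andP: mC.
rewrite (negbTE mC) in uZ; rewrite andFb.
apply: IH => //; first by rewrite size_slide.
by apply: slide_rel => //; rewrite pC.
Qed.

(** All columns of S follow the string at once, since a suffix of the
    columns inherits the pivot: removing columns on the left cannot create
    unmatched opening brackets. *)
Lemma Phi_flip X C Z l : sized (X ++ C :: Z) -> plus C -> pivot X Z ->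
  sw_rel (Phi (drop l (X ++ C :: Z))) (Phi (drop l (X ++ sw C :: Z))) /\
  (0 < free_minus Z ->
   Phi (drop l (X ++ C :: Z)) = Phi (drop l (X ++ sw C :: Z))).
Proof.
rewrite sized_cat => /and3P[zX /eqP zC zZ] pC /andP[/eqP uX /eqP uZ].
have [h|h] := leqP (size X).+1 l.
  by rewrite !drop_cat ltnNge (ltnW h) /= -(subnSK h) /=; split=> //; left.
have {h} : exists X', [/\ sized X', free_minus X' = 0,
    drop l (X ++ C :: Z) = X' ++ C :: Z & drop l (X ++ sw C :: Z) = X' ++ sw C :: Z].
  exists (drop l X); split; first 1 last.
  - exact: free_minus_drop.
  - rewrite drop_cat; case: ltnP => // h2.
    by rewrite (_ : l = size X) ?subnn ?drop_size //; lia.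
  - rewrite drop_cat; case: ltnP => // h2.
    by rewrite (_ : l = size X) ?subnn ?drop_size //; lia.
  - by move: zX; rewrite -{1}(cat_take_drop l X) /sized all_cat => /andP[].
move=> [X' [zX' uX' -> ->]].
have hC : r.+1 < size C by rewrite zC.
have relC : sw_rel C (sw C) by right.
case: X' zX' uX' => [|D X'] zX' uX' /=; first exact: foldl_sw_rel.
have zPhi : size (Phi (D :: X')) = m by apply: size_Phi.
rewrite !foldl_cat /=; apply: foldl_sw_rel => //; first by rewrite size_slide ?zC.
apply: (@slide_sw (Phi (D :: X'))); rewrite ?zPhi //.
exact: Phi_minus.
Qed.

Lemma sorted_sw (X : seq (seq bool)) C C' Z : sorted dom (X ++ C :: Z) ->
  (forall D s, X = rcons s D -> dom D C -> dom D C') ->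
  (forall D s, Z = D :: s -> dom C D -> dom C' D) ->
  sorted dom (X ++ C' :: Z).
Proof.
have H : (forall D s, Z = D :: s -> dom C D -> dom C' D) ->
    path dom C Z -> path dom C' Z.
  by case: Z => //= D s h /andP[/(h D s erefl)-> ->].
case/lastP: X => [|X D] h1 h2 h3; first exact: H h1.
move: h1; rewrite -cats1 -!catA /=.
case: X h2 => [|x X] h2 /=; first by move=> /andP[/(h2 D [::] erefl)-> /=]; apply: H.
rewrite !cat_path /= => /and4P[-> -> /(h2 D (x :: X) erefl)-> /=].
exact: H.
Qed.

Lemma free_minus_rcons s D : free_minus (rcons s D) = 0 -> ~~ minus D.
Proof. by rewrite -cats1 free_minus_cat /= andbT; case: (minus D). Qed.

Lemma sized_rcons s D X : X = rcons s D -> sized X -> size D = m.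
Proof. by move=> ->; rewrite /sized all_rcons => /andP[/eqP]. Qed.

(** Two adjacent columns could only get out of order when the left one is
    [minus] and the right one [plus], which a pivot excludes on both sides. *)
Lemma sorted_flip_plus X C Z : sized (X ++ C :: Z) -> plus C -> pivot X Z ->
  sorted dom (X ++ C :: Z) -> sorted dom (X ++ sw C :: Z).
Proof.
rewrite sized_cat => /and3P[zX /eqP zC zZ] pC /andP[/eqP uX /eqP uZ] srt.
apply: sorted_sw srt _ _ => D s e d.
  have zD := sized_rcons e zX.
  by apply: dom_sw_minus; rewrite ?zD ?plusN.
move: zZ uZ; rewrite e /= => /andP[/eqP zD _] u0.
by apply: dom_swl; rewrite ?zC ?zD //; apply/negP => pD; rewrite pD in u0.
Qed.

Lemma sorted_flip_minus X C Z : sized (X ++ C :: Z) -> minus C -> pivot X Z ->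
  sorted dom (X ++ C :: Z) -> sorted dom (X ++ sw C :: Z).
Proof.
rewrite sized_cat => /and3P[zX /eqP zC zZ] mC /andP[/eqP uX /eqP uZ] srt.
have hC : r.+1 < size C by rewrite zC.
apply: sorted_sw srt _ _ => D s e d.
  have zD := sized_rcons e zX.
  apply: dom_unsw; rewrite ?zD ?sw_size ?swK //.
  by rewrite e in uX; apply: free_minus_rcons uX.
move: zZ; rewrite e /= => /andP[/eqP zD _].
apply: dom_unswl; rewrite ?swK ?sw_size ?zC ?zD // minus_sw //.
by apply/negP => /plusN; rewrite mC.
Qed.

Lemma bit_count_flip cs : sized cs -> 0 < free_plus cs ->
  [/\ forall k, k != r -> k != r.+1 -> bit_count k (flip plus cs) = bit_count k cs,
      bit_count r (flip plus cs) = (bit_count r cs).+1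
    & (bit_count r.+1 (flip plus cs)).+1 = bit_count r.+1 cs].
Proof.
move=> zc ux; have [X [C [Z [e pC pv]]]] := plus_pivot ux; subst cs.
move: zc; rewrite sized_cat flip_plus // => /and3P[_ /eqP zC _].
have hC : r.+1 < size C by rewrite zC.
have [e1 e2] := sw_bits hC.
case/andP: pC => /negbTE h l.
split=> [k h1 h2||]; rewrite !bit_count_cat /bit_count /=; first by rewrite nth_sw.
  by rewrite e1 -/(hi_bit C) h l; lia.
by rewrite e2 -/(lo_bit C) h l; lia.
Qed.

End Strings.

(** * Summation over strings *)

Section Iterates.
Variables (T : eqType) (V : seq T) (free_plus free_minus : T -> nat) (f e : T -> T).
Hypothesis step : forall x, x \in V -> 0 < free_plus x ->
  [/\ f x \in V, free_plus (f x) = (free_plus x).-1,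
      free_minus (f x) = (free_minus x).+1 & e (f x) = x].

Lemma iter_step x j : x \in V -> j <= free_plus x ->
  [/\ iter j f x \in V, free_plus (iter j f x) = free_plus x - j,
      free_minus (iter j f x) = free_minus x + j & iter j e (iter j f x) = x].
Proof.
move=> xV; elim: j => [|j IH] le_j; first by rewrite subn0 addn0.
have [iV iu im ie] := IH (ltnW le_j).
have [|fV fu fm fe] := step iV; first by rewrite iu subn_gt0.
by rewrite [iter _ e _]iterSr /= fe ie fV fu fm iu im; split=> //; lia.
Qed.
End Iterates.

Section StringSum.
Variables (T : eqType) (V : seq T) (free_plus free_minus : T -> nat) (f e : T -> T).
Hypothesis uV : uniq V.
Hypothesis fstep : forall x, x \in V -> 0 < free_plus x ->
  [/\ f x \in V, free_plus (f x) = (free_plus x).-1,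
      free_minus (f x) = (free_minus x).+1 & e (f x) = x].
Hypothesis estep : forall x, x \in V -> 0 < free_minus x ->
  [/\ e x \in V, free_minus (e x) = (free_minus x).-1,
      free_plus (e x) = (free_plus x).+1 & f (e x) = x].

(** Going down [free_minus] steps leads from an element to the first element
    of its string, and j steps are a bijection between the first elements of
    strings of length greater than j and the elements with [free_minus] equal
    to j. *)
Lemma string_sum (A : nmodType) (F : T -> A) :
  (\sum_(x <- V) F x =
   \sum_(x <- V | free_minus x == 0%N) \sum_(j < (free_plus x).+1) F (iter j f x))%R.
Proof.
pose N := \max_(x <- V) maxn (free_minus x) (free_plus x).
have leN x : x \in V -> free_minus x <= N /\ free_plus x <= N.
  move=> xV; have : maxn (free_minus x) (free_plus x) <= N by apply: leq_bigmax_seq.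
  by rewrite geq_max => /andP.
rewrite (partition_big (fun x => inord (free_minus x) : 'I_N.+1) predT) //=.
transitivity (\sum_(j < N.+1)
    \sum_(x <- V | (free_minus x == 0%N) && (j <= free_plus x)%N)
                F (iter j f x))%R.
  apply: eq_bigr => j _.
  have perm_j : perm_eq [seq x <- V | free_minus x == j]
      [seq iter j f x | x <- [seq x <- V | (free_minus x == 0) && (j <= free_plus x)]].
    apply: uniq_perm; first exact: filter_uniq.
      rewrite map_inj_in_uniq ?filter_uniq // => x y.
      rewrite !mem_filter => /andP[/andP[_ jx] xV] /andP[/andP[_ jy] yV] exy.
      have [_ _ _ <-] := iter_step fstep xV jx.
      by have [_ _ _ <-] := iter_step fstep yV jy; rewrite exy.
    move=> x; rewrite mem_filter; apply/andP/mapP.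
      move=> [/eqP ux xV]; have [|eV eu em ee] := iter_step estep xV (j := j).
        by rewrite ux.
      exists (iter j e x); last by rewrite ee.
      by rewrite mem_filter eV eu em ux subnn leq_addl.
    move=> [y]; rewrite mem_filter => /andP[/andP[/eqP uy jy] yV] ->.
    by have [-> _ -> _] := iter_step fstep yV jy; rewrite uy.
  rewrite big_seq_cond (eq_bigl (fun x => (x \in V) && (free_minus x == j))); last first.
    move=> x; apply: andb_id2l => xV; rewrite -val_eqE /= inordK //.
    by have [] := leN _ xV.
  by rewrite -big_seq_cond -big_filter (perm_big _ perm_j) big_map big_filter.
rewrite (exchange_big_dep (fun x => free_minus x == 0%N)) /=; last first.
  by move=> j x _ /andP[].
rewrite big_seq_cond [RHS]big_seq_cond; apply: eq_bigr => x /andP[xV ux].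
rewrite (big_ord_widen N.+1 (fun j => F (iter j f x))); last first.
  by have [] := leN _ xV.
by apply: eq_bigl => j; rewrite ux ltnS.
Qed.
End StringSum.

(** * The operators on polynomials *)

(** Says that rho_i P = Q without dividing, in a form that is additive in the
    pair (P, Q) and can be checked string by string. *)
Definition divided_rel n (i : 'I_n.-1) (P Q : {mpoly int[n]}) : Prop :=
  (('X_(lo i) - 'X_(hi i)) * Q =
   'X_(lo i) * P - 'X_(hi i) * msym (stransp i) P)%R.

Section Rho.
Variables (n : nat) (i : 'I_n.-1).
Implicit Types P Q : {mpoly int[n]}.
Local Open Scope ring_scope.
Notation s := (stransp i).
Notation x := ('X_(lo i) : {mpoly int[n]}).
Notation y := ('X_(hi i) : {mpoly int[n]}).

Lemma msymXU (t : 'S_n) k : msym t 'X_k = 'X_(t k) :> {mpoly int[n]}.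
Proof.
rewrite msymX; congr ('X_[_]); apply/mnmP => j.
by rewrite mnmE !mnm1E -(inj_eq (@perm_inj _ t)) permKV.
Qed.

Lemma lo_neq_hi : lo i != hi i.
Proof. by rewrite -val_eqE /= neq_ltn ltnSn. Qed.

Lemma subX_neq0 : x - y != 0.
Proof.
rewrite subr_eq0; apply/eqP => /(congr1 (mcoeff U_(lo i))).
by rewrite !mcoeffXU eqxx eq_sym (negPf lo_neq_hi).
Qed.

Lemma msym_lo : msym s x = y. Proof. by rewrite msymXU tpermL. Qed.
Lemma msym_hi : msym s y = x. Proof. by rewrite msymXU tpermR. Qed.

Lemma rho_eq P Q : divided_rel i P Q -> rho i P = Q.
Proof.
move=> e; apply: (mulfI subX_neq0); rewrite rhoE e msymM; congr (_ - _ * _).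
exact: msym_lo.
Qed.

Lemma divided_rel_sum (I : eqType) (V : seq I) (p : pred I) (F G : I -> {mpoly int[n]}) :
  (forall h, h \in V -> p h -> divided_rel i (F h) (G h)) ->
  divided_rel i (\sum_(h <- V | p h) F h) (\sum_(h <- V | p h) G h).
Proof.
move=> H; rewrite /divided_rel raddf_sum !mulr_sumr -sumrB big_seq_cond.
by rewrite [RHS]big_seq_cond; apply: eq_bigr => h /andP[hV ph]; apply: H.
Qed.

Lemma sum_string (W : {mpoly int[n]}) k :
  (x - y) * (\sum_(j < k.+1) W * (x ^+ (k - j) * y ^+ j)) =
  W * (x ^+ k.+1 - y ^+ k.+1).
Proof. by rewrite -mulr_sumr mulrCA -subrXX. Qed.

(** On a string, the weights are the terms of a geometric sum times a factor
    symmetric in the two variables. *)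
Lemma divided_rel_head W k : msym s W = W ->
  divided_rel i (W * x ^+ k) (\sum_(j < k.+1) W * (x ^+ (k - j) * y ^+ j)).
Proof.
move=> sW; rewrite /divided_rel sum_string msymM sW rmorphXn /= msym_lo.
by rewrite mulrBr !exprS !(mulrCA W).
Qed.

(** The sum over a string is symmetric, and rho_i fixes symmetric
    polynomials. *)
Lemma divided_rel_string W k : msym s W = W ->
  let Q := \sum_(j < k.+1) W * (x ^+ (k - j) * y ^+ j) in divided_rel i Q Q.
Proof.
move=> sW Q; rewrite /divided_rel.
suff -> : msym s Q = Q by rewrite mulrBl.
have := congr1 (msym s) (sum_string W k).
rewrite -/Q !msymM !msymB !rmorphXn /= msym_lo msym_hi sW => e.
apply: (mulfI subX_neq0); apply: oppr_inj.
by rewrite -mulNr opprB e sum_string -mulrN opprB.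
Qed.
End Rho.

(** * The recursion for sums over tableaux *)

(** The variable of index t stands for the value t+1, whose bit is at position
    n-1-t. *)
Definition cweight n (cs : seq (seq bool)) : {mpoly int[n]} :=
  (\prod_(t < n) 'X_t ^+ bit_count (n.-1 - t) cs)%R.

Definition key_le (Ys cs : seq (seq bool)) : bool :=
  all (fun l => dom (Phi (drop l cs)) (nth [::] Ys l)) (iota 0 (size cs)).

Section DemazureStep.
Variables (n : nat) (i : 'I_n.-1) (L : nat).
Variables (V : seq (seq (seq bool))) (Ys : seq (seq bool)).
(* The position of the bit of the larger of the two values exchanged by s_i. *)
Let r := n - i - 2.
Notation plus := (plus r).
Notation minus := (minus r).
Notation sw := (sw r).
Notation free_plus := (free_plus r).
Notation free_minus := (free_minus r).

Lemma swap_pos_lt : r.+1 < n.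
Proof. by have := ltn_ord i; rewrite /r; lia. Qed.

Local Open Scope ring_scope.

Definition cweight_rest (cs : seq (seq bool)) : {mpoly int[n]} :=
  \prod_(t < n | (t != lo i) && (t != hi i)) 'X_t ^+ bit_count (n.-1 - t) cs.

Lemma cweightE cs : cweight n cs =
  cweight_rest cs * ('X_(lo i) ^+ bit_count r.+1 cs * 'X_(hi i) ^+ bit_count r cs).
Proof.
rewrite /cweight (bigD1 (lo i)) //= (bigD1 (hi i)) /=; last first.
  by rewrite eq_sym lo_neq_hi.
rewrite mulrA mulrC; congr (_ * (_ ^+ bit_count _ _ * _ ^+ bit_count _ _)).
- by have := ltn_ord i; rewrite /r; lia.
- by have := ltn_ord i; rewrite /r; lia.
Qed.

Lemma cweight_rest_sym cs : msym (stransp i) (cweight_rest cs) = cweight_rest cs.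
Proof.
rewrite rmorph_prod; apply: eq_bigr => t /andP[h1 h2] /=.
by rewrite rmorphXn /= msymXU tpermD // eq_sym.
Qed.

Lemma cweight_rest_flip cs : sized n cs -> (0 < free_plus cs)%N ->
  cweight_rest (flip r plus cs) = cweight_rest cs.
Proof.
move=> zc u; have [e _ _] := bit_count_flip swap_pos_lt zc u.
apply: eq_bigr => t /andP[h1 h2]; rewrite e //.
  by apply: contra h2 => /eqP; rewrite -val_eqE /= /r;
    have := ltn_ord i; have := ltn_ord t; lia.
by apply: contra h1 => /eqP; rewrite -val_eqE /= /r;
  have := ltn_ord i; have := ltn_ord t; lia.
Qed.

Local Close Scope ring_scope.

(* [V] lists the tableaux of a shape, closed under the crystal operators; [Ys]
   are the columns of the key Y of a permutation in which the smaller of the two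
   values comes first, so that a column of Y with the larger one has both. *)
Hypothesis uV : uniq V.
Hypothesis sV : forall cs, cs \in V -> sized n cs /\ size cs = L.
Hypothesis pV : forall cs, cs \in V -> 0 < free_plus cs -> flip r plus cs \in V.
Hypothesis mV : forall cs, cs \in V -> 0 < free_minus cs -> flip r minus cs \in V.
Hypothesis sY : forall l, l < L -> size (nth [::] Ys l) = n.
Hypothesis nY : forall l, l < L -> ~~ minus (nth [::] Ys l).
Hypothesis szY : size Ys = L.

Notation sYs := (map sw Ys).

Lemma fstepV x : x \in V -> 0 < free_plus x ->
  [/\ flip r plus x \in V, free_plus (flip r plus x) = (free_plus x).-1,
      free_minus (flip r plus x) = (free_minus x).+1 & flip r minus (flip r plus x) = x].
Proof.
move=> xV ux; have [zx _] := sV xV.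
by have [? ? ?] := flip_plusP swap_pos_lt zx ux; split=> //; apply: pV.
Qed.

Lemma estepV x : x \in V -> 0 < free_minus x ->
  [/\ flip r minus x \in V, free_minus (flip r minus x) = (free_minus x).-1,
      free_plus (flip r minus x) = (free_plus x).+1 & flip r plus (flip r minus x) = x].
Proof.
move=> xV ux; have [zx _] := sV xV.
by have [? ? ?] := flip_minusP swap_pos_lt zx ux; split=> //; apply: mV.
Qed.

Lemma Phi_size x l : x \in V -> l < L -> size (Phi (drop l x)) = n.
Proof.
move=> xV lL; have [zx sx] := sV xV; apply: size_Phi.
  by move: zx; rewrite -{1}(cat_take_drop l x) /sized all_cat => /andP[].
by rewrite -size_eq0 size_drop sx; lia.
Qed.

Lemma key_leP Z x : x \in V ->
  reflect (forall l, l < L -> dom (Phi (drop l x)) (nth [::] Z l)) (key_le Z x).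
Proof.
move=> xV; have [zx sx] := sV xV.
apply: (iffP allP) => H l h; apply: H; first by rewrite mem_iota sx.
by move: h; rewrite mem_iota sx.
Qed.

Lemma nth_sYs l : l < L -> nth [::] sYs l = sw (nth [::] Ys l).
Proof. by move=> h; rewrite (nth_map [::]) ?szY. Qed.

Lemma sw_rel_step x l : x \in V -> 0 < free_plus x ->
  sw_rel r (Phi (drop l x)) (Phi (drop l (flip r plus x))) /\
  (0 < free_minus x -> Phi (drop l x) = Phi (drop l (flip r plus x))).
Proof.
move=> xV ux; have [zx _] := sV xV.
have [X [C [Z [e pC pv]]]] := plus_pivot ux; subst x.
rewrite flip_plus //; have [h1 h2] := Phi_flip swap_pos_lt l zx pC pv.
split=> // h; apply: h2; case/andP: pv h => /eqP uX /eqP uZ.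
by rewrite free_minus_cat uX sub0n addn0 /= (negbTE (plusN pC)).
Qed.

Lemma key_le_down Z x : (forall l, l < L -> size (nth [::] Z l) = n) ->
  x \in V -> 0 < free_plus x -> key_le Z (flip r plus x) -> key_le Z x.
Proof.
move=> sZ xV ux; have [fV _ _ _] := fstepV xV ux.
move=> /(key_leP _ fV) H; apply/key_leP => // l lL.
have [[->|[pPhi e]] _] := sw_rel_step l xV ux; first exact: H.
have := H l lL; rewrite e; apply: dom_unswl; last exact: plusN.
  by rewrite Phi_size ?swap_pos_lt.
by rewrite Phi_size ?sZ.
Qed.

(** Past the first step of a string S does not change. *)
Lemma key_le_eq Z x : x \in V -> 0 < free_plus x -> 0 < free_minus x ->
  key_le Z (flip r plus x) = key_le Z x.
Proof.
move=> xV ux mx; have [fV _ _ _] := fstepV xV ux.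
apply/(key_leP _ fV)/(key_leP _ xV) => H l lL;
  have [_ /(_ mx) e] := sw_rel_step l xV ux.
- by rewrite e; apply: H.
- by rewrite -e; apply: H.
Qed.

Lemma size_sY l : l < L -> size (nth [::] sYs l) = n.
Proof. by move=> lL; rewrite nth_sYs // sw_size sY // swap_pos_lt. Qed.

(** A column of S in which i has become i+1 remains below the exchanged key,
    because a column of that key that contains i contains i+1. *)
Lemma key_le_sw_up x : x \in V -> 0 < free_plus x ->
  key_le sYs (flip r plus x) = key_le sYs x.
Proof.
move=> xV ux; apply/idP/idP; first exact: (key_le_down size_sY).
have [fV _ _ _] := fstepV xV ux.
move=> /(key_leP _ xV) H; apply/(key_leP _ fV) => l lL.
have [[<-|[pPhi ->]] _] := sw_rel_step l xV ux; first exact: H.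
have hP := Phi_size xV lL.
apply: (@dom_swl r) => //; rewrite ?hP ?swap_pos_lt ?size_sY //; first exact: H.
by rewrite nth_sYs // plus_sw ?sY ?swap_pos_lt // nY.
Qed.

(** Neither a column of S at the first element of a string nor a column of Y
    contains i+1 without i, so the number of values at most i is determined by
    its neighbours and the exchange in Y does not matter. *)
Lemma key_le_head x : x \in V -> free_minus x = 0 -> key_le sYs x = key_le Ys x.
Proof.
move=> xV ux; apply/(key_leP _ xV)/(key_leP _ xV) => H l lL; have := H l lL.
  rewrite nth_sYs // => d; apply: (@dom_unsw r) d _;
    rewrite ?Phi_size ?swap_pos_lt ?sY //.
  have [zx sx] := sV xV; apply: (Phi_minus swap_pos_lt); last exact: free_minus_drop.
  by move: zx; rewrite -{1}(cat_take_drop l x) /sized all_cat => /andP[].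
rewrite nth_sYs // => d.
by apply: (@dom_sw_minus r) => //; rewrite ?Phi_size ?swap_pos_lt ?sY // nY.
Qed.

Lemma iter_fV x j : x \in V -> free_minus x = 0 -> j <= free_plus x ->
  [/\ iter j (flip r plus) x \in V, free_plus (iter j (flip r plus) x) = free_plus x - j
    & free_minus (iter j (flip r plus) x) = j].
Proof.
move=> xV mx /(iter_step fstepV xV)[? ? um_j _]; split=> //.
by rewrite um_j mx.
Qed.

Lemma key_le_sw_iter x j : x \in V -> free_minus x = 0 -> j <= free_plus x ->
  key_le sYs (iter j (flip r plus) x) = key_le sYs x.
Proof.
move=> xV mx; elim: j => //= j IH h.
have [jV uj _] := iter_fV xV mx (ltnW h).
by rewrite key_le_sw_up ?uj ?subn_gt0 // IH // ltnW.
Qed.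

Lemma key_le_iter x j : x \in V -> free_minus x = 0 -> 0 < j <= free_plus x ->
  key_le Ys (iter j (flip r plus) x) = key_le Ys (flip r plus x).
Proof.
move=> xV mx; elim: j => //= -[|j] IH // h.
have hj : j.+1 <= free_plus x by lia.
have [jV uj mj] := iter_fV xV mx hj.
by rewrite key_le_eq ?uj ?mj ?IH //; lia.
Qed.

Local Open Scope ring_scope.

Lemma cweight_iter x j : x \in V -> free_minus x = 0%N -> (j <= free_plus x)%N ->
  cweight n (iter j (flip r plus) x) =
  (cweight_rest x * ('X_(lo i) * 'X_(hi i)) ^+ bit_count r x) *
  ('X_(lo i) ^+ (free_plus x - j) * 'X_(hi i) ^+ j).
Proof.
move=> xV mx hj.
have [eW elo ehi] : [/\ cweight_rest (iter j (flip r plus) x) = cweight_rest x,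
    (bit_count r.+1 (iter j (flip r plus) x) + j = bit_count r.+1 x)%N
  & (bit_count r (iter j (flip r plus) x) = bit_count r x + j)%N].
  elim: j hj => [|j IH] h /=; first by rewrite !addn0.
  have [eW elo ehi] := IH (ltnW h).
  have [jV uj mj] := iter_fV xV mx (ltnW h).
  have [zj _] := sV jV.
  have u0 : (0 < free_plus (iter j (flip r plus) x))%N by rewrite uj subn_gt0.
  have [_ c1 c2] := bit_count_flip swap_pos_lt zj u0.
  by rewrite cweight_rest_flip // eW; split=> //; lia.
have e := bit_count_signs r x; rewrite mx addn0 in e.
rewrite cweightE eW ehi.
have -> : bit_count r.+1 (iter j (flip r plus) x) =
    (bit_count r x + (free_plus x - j))%N by lia.
by rewrite exprMn !exprD -!mulrA; congr (_ * (_ * _)); rewrite mulrCA.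
Qed.

(** The first element of a string is below Y if and only if all elements are
    below the exchanged key, and the other elements are below Y all together or
    not at all. *)
Theorem demazure_step :
  rho i (\sum_(cs <- V | key_le Ys cs) cweight n cs) =
  \sum_(cs <- V | key_le sYs cs) cweight n cs.
Proof.
apply: rho_eq.
rewrite [X in divided_rel _ X]big_mkcond [X in divided_rel _ _ X]big_mkcond.
rewrite !(string_sum uV fstepV estepV).
apply: divided_rel_sum => x xV /eqP mx.
pose W := cweight_rest x * ('X_(lo i) * 'X_(hi i)) ^+ bit_count r x.
have sW : msym (stransp i) W = W.
  by rewrite msymM rmorphXn /= msymM msym_lo msym_hi cweight_rest_sym (mulrC 'X_(hi i)).
pose G j := W * ('X_(lo i) ^+ (free_plus x - j) * 'X_(hi i) ^+ j).
have -> : \sum_(j < (free_plus x).+1) (if key_le sYs (iter j (flip r plus) x)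
    then cweight n (iter j (flip r plus) x) else 0) =
    if key_le Ys x then \sum_(j < (free_plus x).+1) G j else 0.
  rewrite -(key_le_head xV mx); case: ifP => kx; last first.
    by apply: big1 => j _; rewrite key_le_sw_iter // ?kx // -ltnS.
  by apply: eq_bigr => j _; rewrite key_le_sw_iter ?kx ?cweight_iter // -ltnS.
have [kx|kx] := boolP (key_le Ys x); last first.
  rewrite big1; first by rewrite /divided_rel raddf0 !mulr0 subrr.
  move=> j _; case: ifP => // kj; case/negP: kx.
  have hj : (j <= free_plus x)%N by rewrite -ltnS.
  rewrite -(key_le_head xV mx) -(key_le_sw_iter xV mx hj).
  move: kj hj; case: (val j) => [|j'] kj hj; first by rewrite /= key_le_head.
  rewrite key_le_sw_iter // key_le_head //; apply: (key_le_down sY) => //.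
    by apply: leq_trans hj.
  by rewrite -(key_le_iter xV mx (j := j'.+1)).
have [k1|k1] := boolP (key_le Ys (flip r plus x)).
  rewrite (_ : \sum_(j < _) _ = \sum_(j < (free_plus x).+1) G j).
    exact: divided_rel_string.
  apply: eq_bigr => j _; have hj : (j <= free_plus x)%N by rewrite -ltnS.
  rewrite /G /W -cweight_iter //; case: (posnP j) => [->|j0]; first by rewrite /= kx.
  by rewrite key_le_iter ?j0 // k1.
rewrite big_ord_recl [X in _ + X]big1; last first.
  move=> j _; have hj : (0 < lift ord0 j <= free_plus x)%N by rewrite -ltnS ltn_ord.
  by rewrite key_le_iter // (negbTE k1).
rewrite /= kx addr0; have -> : cweight n x = W * 'X_(lo i) ^+ free_plus x.
  by have := cweight_iter xV mx (leq0n _); rewrite /= subn0 expr0 mulr1.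
exact: divided_rel_head.
Qed.
End DemazureStep.

(** * Shapes *)

Lemma mem_itv p q i : (i \in itv p q) = (p <= i <= q).
Proof. by rewrite /itv mem_index_iota ltnS. Qed.

Lemma collen_anti lam j j' : j <= j' -> collen lam j' <= collen lam j.
Proof. by move=> le_j; apply: sub_count => x; apply: leq_trans. Qed.

Lemma mem_cells lam j i :
  ((j, i) \in cells lam) = (0 < j <= rowlen lam 1) && (0 < i <= collen lam j).
Proof.
rewrite -!mem_itv; apply/allpairsPdep/andP => [[j' [i' [hj hi [-> ->]]]]|[hj hi]] //.
by exists j, i.
Qed.

Lemma conjugateE (lam : seq nat) i j : sorted geq lam -> 0 < i -> 0 < j ->
  (i <= collen lam j) = (j <= rowlen lam i).
Proof.
rewrite /rowlen /collen; case: i => // i srt _ j0 /=.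
elim: lam i srt => [|x s IH] i srt; first by rewrite nth_nil ltn0 leqn0; case: j j0.
have x_s : all (geq x) s.
  by apply: (order_path_min _ srt) => a b c /= h1 h2; apply: leq_trans h2 h1.
rewrite /=; case: (leqP j x) => [le_jx|lt_xj].
  case: i => [|i] //=; rewrite ltnS IH //; exact: path_sorted srt.
have all_x : all (fun y => y < j) s.
  by apply: sub_all x_s => y /= h; apply: leq_ltn_trans h lt_xj.
have -> : count (leq j) s = 0.
  apply/eqP; rewrite -leqn0 leqNgt -has_count; apply/hasPn => y ys.
  by rewrite -ltnNge; apply: (allP all_x).
case: i => [|i] /=; first by rewrite [RHS]leqNgt lt_xj.
rewrite [RHS]leqNgt; apply/esym/negbF.
have [lt_i|le_i] := ltnP i (size s); first exact: (all_nthP 0 all_x).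
by rewrite nth_default.
Qed.

(** * Scanning paths *)

Section Scan.
Variables (lam : seq nat) (T : nat * nat -> nat).
Notation z := (collen lam).
Notation L := (rowlen lam 1).

Section Path.
Variable h : nat -> nat.

(** The value reached by a path after column c, when h gives the heights of
    the columns of what is left of the tableau; 0 before the path starts. *)
Fixpoint value c : nat :=
  if c is c'.+1 then
    if (0 < h c) && (value c' <= T (c, h c)) then T (c, h c) else value c'
  else 0.

Definition taken c := (0 < h c) && (value c.-1 <= T (c, h c)).

Lemma valueS c : value c.+1 = if taken c.+1 then T (c.+1, h c.+1) else value c.
Proof. by []. Qed.

Lemma value_mono c c' : c <= c' -> value c <= value c'.
Proof.
elim: c' => [|c' IH]; first by rewrite leqn0 => /eqP->.
rewrite leq_eqVlt => /orP[/eqP->//|]; rewrite ltnS => /IH h1.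
by rewrite valueS /taken /=; case: ifP => // /andP[_]; apply: leq_trans.
Qed.

(** An earliest weakly increasing subsequence ends with the maximum of the
    sequence. *)
Lemma value_leP c y : reflect
  (forall a, 0 < a <= c -> 0 < h a -> T (a, h a) <= y) (value c <= y).
Proof.
elim: c => [|c IH].
  by apply: (iffP idP) => // _ [|a].
apply: (iffP idP) => [H a|H].
  case/andP=> a0; rewrite leq_eqVlt ltnS => /orP[/eqP-> h0|le_a h0].
    apply: leq_trans H; rewrite valueS /taken h0 /=.
    by case: ifP => // /negbT; rewrite -ltnNge => /ltnW.
  by move/IH: (leq_trans (value_mono (leqnSn c)) H); apply=> //; rewrite a0.
rewrite valueS; case: ifP => [/andP[h0 _]|_]; first by apply: H; rewrite ?leqnn.
by apply/IH => a /andP[a0 ac]; apply: H; rewrite a0 ltnW.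
Qed.

Definition column_bottoms := [seq (c, h c) | c <- itv 1 L & 0 < h c].

Definition path_cells := [seq (c, h c) | c <- itv 1 L & taken c].

Lemma ewis_column_bottoms : ewis T column_bottoms = path_cells.
Proof.
have -> : ewis T column_bottoms = ewis_from T 0 column_bottoms by case: column_bottoms.
rewrite /column_bottoms /path_cells /itv /index_iota subn1 /=.
suff H k a : ewis_from T (value a) [seq (c, h c) | c <- iota a.+1 k & 0 < h c] =
    [seq (c, h c) | c <- iota a.+1 k & taken c] by exact: (H L 0).
elim: k a => //= k IH a; have := IH a.+1; rewrite valueS /taken /=.
by case: (0 < h a.+1) => //=; case: ifP => //= _ ->.
Qed.

Lemma mem_path c r :
  ((c, r) \in path_cells) = [&& 0 < c <= L, taken c & r == h c].
Proof.
apply/mapP/and3P => [[c']|[hc tc /eqP->]].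
  by rewrite mem_filter mem_itv => /andP[tc hc] [-> ->]; rewrite eqxx.
by exists c => //; rewrite mem_filter tc mem_itv.
Qed.

Lemma last_path c : T (0, 0) = 0 -> c <= L ->
  T (last (0, 0) [seq b <- path_cells | b.1 <= c]) = value c.
Proof.
move=> T0; rewrite filter_map -filter_predI.
rewrite (eq_filter (a2 := fun a => taken a && (a <= c))); last first.
  by move=> a /=; rewrite andbC.
rewrite filter_predI /itv /index_iota subn1 /= => le_c.
have -> : [seq a <- iota 1 L | a <= c] = iota 1 c.
  rewrite -{1}(subnKC le_c) iotaD filter_cat.
  rewrite (eq_in_filter (a2 := predT)) ?filter_predT; last first.
    by move=> a; rewrite mem_iota add1n ltnS => /andP[].
  rewrite (eq_in_filter (a2 := pred0)) ?filter_pred0 ?cats0 //.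
  by move=> a; rewrite mem_iota add1n => /andP[+ _]; rewrite ltnNge => /negbTE.
elim: c {le_c} => // c IH.
rewrite -{1}(addn1 c) iotaD filter_cat map_cat add1n [filter _ (iota _ 1)]/= valueS.
case: (taken c.+1) => /=; last by rewrite cats0 IH.
by rewrite last_cat.
Qed.

Lemma value_cell c : 0 < value c ->
  exists2 a, 0 < a <= c & taken a /\ value c = T (a, h a).
Proof.
elim: c => // c IH; rewrite valueS; case: ifP => [tc _|_ /IH[a ha ta]].
  by exists c.+1 => //; rewrite ltnS leqnn.
by exists a => //; case/andP: ha => ->; apply: leqW.
Qed.

Lemma bottomsE : (forall c, h c <= z c) ->
  bottoms [seq c <- cells lam | c.2 <= h c.1] = column_bottoms.
Proof.
move=> hz; rewrite /bottoms -filter_predI.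
rewrite (eq_in_filter (a2 := fun c => c.2 == h c.1)); last first.
  move=> [j i] hc /=; rewrite mem_filter /=; move: hc; rewrite !mem_cells.
  move=> /andP[-> /andP[i0 iz]] /=; have := hz j.
  by case: (ltngtP i (h j)) => //=; lia.
rewrite /cells /column_bottoms filter_flatten -map_comp.
elim: (itv 1 L) => //= j s ->.
rewrite filter_map /=.
rewrite (eq_filter (a2 := pred1 (h j))) //; case: ifP => h0.
  by rewrite filter_pred1_uniq ?iota_uniq // mem_itv h0 hz.
rewrite (eq_in_filter (a2 := pred0)) ?filter_pred0 //.
by move=> i; rewrite mem_itv /=; lia.
Qed.
End Path.

(** The heights of the columns after the removal of the first d paths that
    start in column l. *)
Fixpoint height (l d : nat) : nat -> nat :=
  if d is d'.+1 then
    fun c => height l d' c - taken (height l d') c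
  else fun c => if l <= c then z c else 0.

Lemma height_le l d c : height l d c <= z c.
Proof.
elim: d => [|d IH] /=; first by case: ifP.
exact: leq_trans (leq_subr _ _) IH.
Qed.

Lemma scan_boxesE l d :
  scan_boxes lam T l d = [seq c <- cells lam | c.2 <= height l d c.1].
Proof.
elim: d => [|d IH] /=.
  apply: eq_in_filter => -[j i]; rewrite mem_cells /= => /andP[_ /andP[i0 iz]].
  by case: ifP => _; rewrite ?iz // leqn0 eqn0Ngt i0.
rewrite IH bottomsE ?ewis_column_bottoms; last by move=> c; apply: height_le.
rewrite -filter_predI; apply: eq_in_filter => -[j i].
rewrite mem_cells /= mem_path => /andP[-> /= /andP[i0 _]].
case: (taken _ j) => /=; last by rewrite subn0.
by case: eqP => /=; lia.
Qed.

Lemma scan_pathE l k :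
  scan_path lam T l k = path_cells (height l (z l - k)).
Proof.
rewrite /scan_path /Tboxes scan_boxesE bottomsE ?ewis_column_bottoms // => c.
exact: height_le.
Qed.

Lemma height_anti l c d d' : d <= d' -> height l d' c <= height l d c.
Proof.
elim: d' => [|d' IH]; first by rewrite leqn0 => /eqP->.
rewrite leq_eqVlt => /orP[/eqP->//|/IH]; apply: leq_trans.
exact: leq_subr.
Qed.

Lemma height_left l d c : c < l -> height l d c = 0.
Proof.
move=> lt_c; apply/eqP; rewrite -leqn0.
by apply: leq_trans (height_anti _ _ (leq0n d)) _; rewrite /= (leqNgt l) lt_c.
Qed.

Lemma value_left l d c : c < l -> value (height l d) c = 0.
Proof.
move=> lt_c; apply/eqP; rewrite -leqn0; apply/value_leP => a /andP[_ ac].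
by rewrite height_left //; apply: leq_ltn_trans lt_c.
Qed.

Lemma taken_first l d : 0 < l -> taken (height l d) l = (0 < height l d l).
Proof.
by move=> l0; rewrite /taken value_left ?andbT // prednK.
Qed.

Lemma height_first l d : 0 < l -> height l d l = z l - d.
Proof.
move=> l0; elim: d => [|d IH] /=; first by rewrite leqnn subn0.
by rewrite taken_first // IH; case: ltnP => /= ; lia.
Qed.

Hypothesis T_row : forall c r, 0 < c -> 0 < r <= z c.+1 -> T (c, r) <= T (c.+1, r).

(** What is left is always a shape: if columns c and c+1 have the same height
    and the path takes the bottom of column c, then by the row condition it also
    takes the bottom of column c+1. *)
Lemma height_shape l d c : 0 < l <= c -> height l d c.+1 <= height l d c.
Proof.
move=> /andP[l0 lc]; elim: d => [|d IH] /=.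
  by rewrite lc (leqW lc); apply: collen_anti.
have := IH; rewrite leq_eqVlt => /orP[/eqP e|]; last first.
  by case: (taken _ c) (taken _ c.+1) => [] []; lia.
case tc : (taken _ c) => /=; last by rewrite subn0 e leq_subr.
have -> : taken (height l d) c.+1; last by rewrite e.
move: (tc); rewrite /taken e => /andP[h0 _]; rewrite h0 /=.
have -> : value (height l d) c = T (c, height l d c).
  by case: c l0 lc tc {IH e h0} => [|c] l0 lc tc; [lia | rewrite valueS tc].
apply: T_row; first exact: leq_trans lc.
by rewrite h0 -e height_le.
Qed.

Lemma height_shape_le l d c : 0 < l <= c -> height l d c <= height l d l.
Proof.
move=> /andP[l0 /subnKC<-]; elim: (c - l) => [|k IH]; first by rewrite addn0.
by rewrite addnS; apply: leq_trans IH; apply: height_shape; rewrite l0 leq_addr.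
Qed.

Lemma height_end l c : 0 < l <= c -> height l (z l) c = 0.
Proof.
move=> hlc; apply/eqP; rewrite -leqn0; apply: leq_trans (height_shape_le _ hlc) _.
by case/andP: hlc => l0 _; rewrite height_first // subnn.
Qed.

Hypothesis lam_sorted : sorted geq lam.

Lemma le_first_row j i : 0 < j -> 0 < i <= z j -> j <= L.
Proof.
move=> j0 /andP[i0 iz]; rewrite -conjugateE //; exact: leq_trans i0 iz.
Qed.

(** The height of column c falls to 0 in steps of at most one, and every such
    step is a path through the bottom box. *)
Lemma taken_exists l c k : 0 < l <= c -> 0 < k <= z c ->
  exists2 d, d < z l & taken (height l d) c /\ height l d c = k.
Proof.
move=> hlc /andP[k0 kz].
have ex : exists d, height l d c < k by exists (z l); rewrite height_end.
case: (ex_minnP ex) => -[|d] Hd dmin.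
  by move: Hd; rewrite /= (andP hlc).2 ltnNge kz.
have ge : k <= height l d c by rewrite leqNgt; apply/negP => /dmin; rewrite ltnn.
exists d; first by apply: dmin; rewrite height_end.
by move: Hd; rewrite /=; case: (taken _ c) => /=; lia.
Qed.

(** The last clause turns comparisons of path indices into comparisons of
    heights, where the shape property applies. *)
Lemma path_indexP l c k (i := path_index lam T l (c, k)) :
  0 < l <= c -> 0 < k <= z c ->
  [/\ 0 < i <= z l, taken (height l (z l - i)) c, height l (z l - i) c = k
    & forall d, (k <= height l d c) = (d <= z l - i)].
Proof.
move=> hlc hk; have [d dz [td hd]] := taken_exists hlc hk.
have cL : 0 < c <= L.
  have c0 : 0 < c by case/andP: hlc; apply: leq_trans.
  by rewrite c0 (le_first_row c0 hk).
have : i \in [seq i <- itv 1 (z l) | (c, k) \in scan_path lam T l i].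
  rewrite /i /path_index.
  have : z l - d \in [seq i <- itv 1 (z l) | (c, k) \in scan_path lam T l i].
    rewrite mem_filter mem_itv scan_pathE mem_path cL subKn ?(ltnW dz) // td hd.
    by rewrite eqxx /= subn_gt0 dz leq_subr.
  by case: [seq _ <- _ | _] => //= a s _; rewrite mem_head.
rewrite mem_filter mem_itv scan_pathE mem_path => /andP[/and3P[_ ti /eqP ei] hi].
split=> // d'; apply/idP/idP => [|le_d]; last by rewrite {1}ei height_anti.
apply: contraLR; rewrite -!ltnNge => lt_d.
apply: leq_ltn_trans (height_anti _ _ lt_d) _; rewrite /= ti -ei.
by case/andP: hk; lia.
Qed.

Lemma path_index_eq l c k d : 0 < l <= c -> d < z l ->
  taken (height l d) c -> height l d c = k -> path_index lam T l (c, k) = z l - d.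
Proof.
move=> hlc dz td hd.
have hk : 0 < k <= z c.
  by rewrite -hd height_le andbT; case/andP: td.
have [hi ti ei H] := path_indexP hlc hk.
set i := path_index _ _ _ _ in hi ti ei H *.
have : d <= z l - i by rewrite -H hd.
have : ~~ (d.+1 <= z l - i).
  by rewrite -H /= td hd; case/andP: hk; lia.
by lia.
Qed.

Definition scan_value l k := value (height l (z l - k)) L.

Variable n : nat.
Hypothesis T_bound : forall c r, 0 < c -> 0 < r <= z c -> T (c, r) <= n.

Hypothesis T_col : forall c r, 0 < c -> 0 < r < z c -> T (c, r) < T (c, r.+1).
Hypothesis T_pos : forall c r, 0 < c -> 0 < r <= z c -> 0 < T (c, r).

Lemma T_ge_row c r : 0 < c -> 0 < r <= z c -> r <= T (c, r).
Proof.
move=> c0; elim: r => // -[|r] IH /andP[_ rz]; first by apply: T_pos => //; rewrite rz.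
apply: leq_ltn_trans (IH _) (T_col _ _) => //; exact: ltnW.
Qed.

(** For a semistandard T, the bounds of the interval other than Y(l,k) hold,
    and S(l,k) is the larger of T(l,k) and the maximum of U. *)
Lemma setAE (pi : 'S_n) l k : (l, k) \in cells lam ->
  (T (l, k) \in setA lam T pi l k) = (scan_value l k <= key lam pi (l, k)).
Proof.
rewrite mem_cells => /andP[/andP[l0 lL] hk]; set y := key _ _ _.
have [k0 kz] := andP hk.
have ehl : height l (z l - k) l = k by rewrite height_first // subKn.
rewrite /setA -/y.
set U := Uboxes _ _ _ _.
have eU : bottoms U = [seq c <- column_bottoms (height l (z l - k)) | c.1 != l].
  rewrite -bottomsE; last exact: height_le.
  rewrite /bottoms /U /Uboxes /Tboxes scan_boxesE -!filter_predI.
  apply: eq_filter => -[a b] /=; rewrite !mem_filter /=.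
  by case: (a != l); rewrite ?andbT ?andbF.
have mU : (max_bottom T U <= y) && (T (l, k) <= y) = (scan_value l k <= y).
  apply/andP/value_leP => [[h1 h2] a ha h0|H].
    have [->|ne] := eqVneq a l; first by rewrite ehl.
    apply: leq_trans h1; rewrite /max_bottom.
    have aU : (a, height l (z l - k) a) \in bottoms U.
      rewrite eU mem_filter ne; apply/mapP; exists a => //.
      by rewrite mem_filter h0 mem_itv.
    case: (U) aU => // u U1 aU.
    exact: (leq_bigmax_seq (r := bottoms (u :: U1)) (P := predT) (F := T) _ aU isT).
  have h2 : T (l, k) <= y by rewrite -{1}ehl; apply: H; rewrite ?l0 ?ehl.
  split=> //; rewrite /max_bottom; case eU' : U => [|u U'].
    by apply: leq_trans (T_pos l0 hk) h2.
  rewrite -eU' eU; apply/bigmax_leqP_seq => -[a b].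
  rewrite mem_filter => /andP[_ /mapP[c]]; rewrite mem_filter mem_itv.
  by move=> /andP[h0 hc] [-> ->] _; apply: H.
rewrite -mU [max_bottom _ _ <= _]leqNgt; case: ifP => //= _.
rewrite mem_itv !leq_min T_ge_row //=.
have -> : T (l, k) <= T_below n lam T l k - 1.
  rewrite /T_below; case: eqP => [_|ne]; first by rewrite subn1 T_bound.
  have : T (l, k) < T (l, k.+1) by apply: T_col; rewrite ?k0 //=; lia.
  by case: (T (l, k.+1)) => // t; rewrite subn1.
suff -> : T (l, k) <= T_right n lam T l k by rewrite !andbT.
rewrite /T_right; case: eqP => [_|/eqP ne]; first exact: T_bound.
apply: T_row; rewrite // k0 conjugateE //=.
by rewrite ltn_neqAle ne -conjugateE.
Qed.

Hypothesis T00 : T (0, 0) = 0.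
Hypothesis lam_n : size lam = n.

Lemma collen_n c : z c <= n. Proof. by rewrite -lam_n count_size. Qed.

Lemma size_one_line (pi : 'S_n) : size (one_line pi) = n.
Proof. by rewrite size_map size_enum_ord. Qed.

Lemma key_mono (pi : 'S_n) c r r' : 0 < r -> r <= r' <= z c ->
  key lam pi (c, r) <= key lam pi (c, r').
Proof.
move=> r0 /andP[rr' rz]; rewrite /key /=.
apply: (sorted_leq_nth leq_trans leqnn 0 (sort_sorted leq_total _)).
- by rewrite inE size_sort size_takel ?size_one_line ?collen_n //; lia.
- by rewrite inE size_sort size_takel ?size_one_line ?collen_n //; lia.
- by lia.
Qed.

(** The path from column j through (l,k) is a member of the union: its index
    lies in the required range because what is left is always a shape, its
    value before column l is at most T(l,k), and its end is S(j,i). *)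
Lemma setB_scan (pi : 'S_n) l k : (l, k) \in cells lam ->
  (forall j i, (j, i) \in cells lam -> scan_value j i <= key lam pi (j, i)) ->
  T (l, k) \in setB lam T pi l k.
Proof.
rewrite mem_cells => /andP[/andP[l0 lL] hk] H; have [k0 kz] := andP hk.
apply/allP => j; rewrite mem_itv => /andP[j0 jl].
have jL : j <= L by apply: leq_trans lL.
have [ej|nej] := eqVneq j l.
  subst j; apply/hasP; exists k; first by rewrite mem_itv /a_index /b_index eqxx; lia.
  rewrite /Eval eqxx mem_itv T_ge_row //=.
  have := H l k; rewrite mem_cells l0 lL hk => /(_ isT); apply: leq_trans.
  have ehl : height l (z l - k) l = k by rewrite height_first // subKn.
  have /value_leP := leqnn (scan_value l k); move/(_ l).
  by rewrite ehl l0 lL; apply.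
have jl' : 0 < j <= l.-1 by lia.
have hjl : 0 < j <= l by rewrite j0.
have [hi ti ei Hi] := path_indexP hjl hk.
set i := path_index _ _ _ _ in hi ti ei Hi.
have hk' : 0 < k <= z l.-1 by rewrite k0 (leq_trans kz) // collen_anti // leq_pred.
apply/hasP; exists i.
  rewrite mem_itv /a_index /b_index (negbTE nej).
  apply/andP; split.
    have [ha _ _ Ha] := path_indexP jl' hk'.
    set a := path_index _ _ _ _ in ha Ha *.
    suff : z j - i <= z j - a by lia.
    rewrite -Ha -{1}ei.
    by have := height_shape (z j - i) jl'; rewrite prednK.
  case: ltnP => [lt_k|_]; last by lia.
  have [hb _ _ Hb] := path_indexP hjl (lt_k : 0 < k.+1 <= z l).
  set b := path_index _ _ _ _ in hb Hb *.
  suff : ~~ (z j - i <= z j - b) by lia.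
  by rewrite -Hb ei ltnn.
rewrite mem_itv /Eval (negbTE nej) scan_pathE.
rewrite (eq_filter (a2 := fun b => b.1 <= l.-1)); last first.
  by move=> b; rewrite -{1}(prednK l0) ltnS.
rewrite last_path ?(leq_trans (leq_pred l)) //.
have := H j i; rewrite mem_cells j0 jL hi => /(_ isT) Hji.
move: (ti); rewrite {1}/taken ei => /andP[_ ->] /=.
apply: leq_trans Hji; rewrite /scan_value.
apply: leq_trans (value_mono _ lL); rewrite -(prednK l0) valueS prednK // ti.
by rewrite ei.
Qed.

(** A path from column j with an index i in the range that is removed before
    the path through (l,k) finds (l,k) at the bottom of column l and passes over
    it, so its value there exceeds T(l,k); hence i is at most the index of the
    path through (l,k), and Y increases down its columns. *)
Lemma setB_path (pi : 'S_n) l k j : (l, k) \in cells lam -> 0 < j <= l ->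
  T (l, k) \in setB lam T pi l k ->
  T (l, k) <= key lam pi (j, path_index lam T j (l, k)).
Proof.
rewrite mem_cells => /andP[/andP[l0 lL] hk] hjl; have [k0 kz] := andP hk.
have [j0 jl] := andP hjl.
move=> /allP/(_ j); rewrite mem_itv j0 jl => /(_ isT) /hasP[i].
rewrite !mem_itv.
have [hi0 ti0 ei0 Hi0] := path_indexP hjl hk.
set i0 := path_index _ _ _ _ in hi0 ti0 ei0 Hi0 *.
have [ej|nej] := eqVneq j l.
  subst j; rewrite /a_index /b_index eqxx => hi /andP[_ /leq_trans]; apply.
  suff -> : i0 = i by [].
  rewrite /i0 (path_index_eq (d := z l - k)) ?subKn ?leqnn ?l0 //; try by lia.
    by rewrite taken_first // height_first // subKn.
  by rewrite height_first // subKn.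
rewrite /a_index /b_index /Eval (negbTE nej) scan_pathE => /andP[ia ib].
rewrite (eq_filter (a2 := fun b => b.1 <= l.-1)); last first.
  by move=> b; rewrite -{1}(prednK l0) ltnS.
rewrite last_path ?(leq_trans (leq_pred l)) // => /andP[hE hY].
have jl' : 0 < j <= l.-1 by lia.
have hk' : 0 < k <= z l.-1 by rewrite k0 (leq_trans kz) // collen_anti // leq_pred.
have [ha _ _ _] := path_indexP jl' hk'.
have [le_i|lt_i] := leqP i i0.
  by apply: leq_trans hY _; apply: key_mono; lia.
have izj : i <= z j.
  move: ib; case: ltnP => [lt_k|_]; last by lia.
  by have [hb _ _ _] := path_indexP hjl (lt_k : 0 < k.+1 <= z l); lia.
have eik : height j (z j - i) l = k.
  apply/eqP; rewrite eqn_leq Hi0; apply/andP; split; last by lia.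
  move: ib; case: ltnP => [lt_k|le_k] ib; last exact: leq_trans (height_le _ _ _) le_k.
  have [hb _ _ Hb] := path_indexP hjl (lt_k : 0 < k.+1 <= z l).
  by rewrite leqNgt Hb; lia.
have nt : ~~ taken (height j (z j - i)) l.
  apply/negP => t.
  have : k <= height j (z j - i).+1 l by rewrite Hi0; lia.
  by rewrite /= t eik; lia.
by move: nt; rewrite /taken eik k0 hE.
Qed.

(** S(j,i) is the value in some box of the path P(T;j,i). *)
Lemma scan_setB (pi : 'S_n) :
  (forall c, c \in cells lam -> T c \in setB lam T pi c.1 c.2) ->
  forall j i, (j, i) \in cells lam -> scan_value j i <= key lam pi (j, i).
Proof.
move=> H j i; rewrite mem_cells => /andP[/andP[j0 jL] hi].
have [->//|/value_cell[c /andP[c0 cL] [tc e]]] := posnP (scan_value j i).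
rewrite /scan_value e; set k := height _ _ c.
have jc : 0 < j <= c.
  rewrite j0 leqNgt; apply/negP => lt_c; move: tc.
  by rewrite /taken height_left.
have hk : 0 < k <= z c by rewrite height_le andbT; case/andP: tc.
have cc : (c, k) \in cells lam by rewrite mem_cells c0 cL hk.
have := setB_path cc jc (H _ cc).
rewrite (path_index_eq jc _ tc) //; first by rewrite subKn //; case/andP: hi.
by case/andP: hi; lia.
Qed.
End Scan.

(** * Scanning one column at a time *)

Fixpoint bits (n : nat) (s : seq nat) : seq bool :=
  if n is k.+1 then (k.+1 \in s) :: bits k s else [::].

Lemma size_bits n s : size (bits n s) = n.
Proof. by elim: n => //= n ->. Qed.

Lemma nth_bits n s k : k < n -> nth false (bits n s) k = (n - k \in s).
Proof.
elim: n k => // n IH [|k] lt_k /=; first by rewrite subn0.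
by rewrite IH // subSS.
Qed.

Lemma eq_bits n s s' : (forall t, 0 < t <= n -> (t \in s) = (t \in s')) ->
  bits n s = bits n s'.
Proof.
elim: n => //= n IH H; rewrite H ?leqnn // IH // => t /andP[t0 tn].
by apply: H; rewrite t0 ltnW.
Qed.

Lemma drop_bits n s k : drop k (bits n s) = bits (n - k) s.
Proof.
by elim: n k => [|n IH] [|k] //=; rewrite IH subSS.
Qed.

Lemma count_bits n s : uniq s -> all (leq 1) s ->
  count id (bits n s) = count (fun x => x <= n) s.
Proof.
move=> us ps; elim: n => [|n IH] /=.
  apply/esym/eqP; rewrite -leqn0 leqNgt -has_count; apply/hasPn => x xs.
  by rewrite -ltnNge; apply: (allP ps).
rewrite IH -(count_uniq_mem _ us) {IH us ps}.
by elim: s => //= x s; case: (ltngtP x n.+1) => h; rewrite ?h; lia.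
Qed.

Lemma suffix_count_bits n s k : uniq s -> all (leq 1) s ->
  suffix_count k (bits n s) = count (fun x => x <= n - k) s.
Proof. by move=> us ps; rewrite /suffix_count drop_bits count_bits. Qed.

Lemma count_sorted (us : seq nat) t k : sorted ltn us ->
  (k < count (fun x => x <= t) us) = (k < size us) && (nth 0 us k <= t).
Proof.
elim: us k => [|u us IH] k // srt.
have IH' := IH _ (path_sorted srt).
have gt_u : all (fun x => u < x) us by apply: order_path_min srt; apply: ltn_trans.
rewrite /=; case: (leqP u t) => [le_u|lt_u].
  by case: k => [|k] //=; rewrite add1n ltnS IH'.
have -> : count (fun x => x <= t) us = 0.
  apply/eqP; rewrite -leqn0 leqNgt -has_count; apply/hasPn => y ys.
  by rewrite -ltnNge; apply: ltn_trans lt_u (allP gt_u _ ys).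
apply/esym/negbTE; case: k => [|k] /=; first by rewrite -ltnNge.
apply/negP => /andP[lt_k]; apply/negP; rewrite -ltnNge.
exact: ltn_trans lt_u (all_nthP 0 gt_u _ lt_k).
Qed.

Lemma dom_bits n us ws : sorted ltn us -> sorted ltn ws ->
  all (leq 1) us -> all (leq 1) ws -> all (fun x => x <= n) ws ->
  size ws <= size us ->
  reflect (forall k, k < size ws -> nth 0 us k <= nth 0 ws k)
    (dom (bits n us) (bits n ws)).
Proof.
move=> su sw pu pw nw le_s.
have uu := sorted_uniq ltn_trans ltnn su.
have uw := sorted_uniq ltn_trans ltnn sw.
apply: (iffP (domP _)); rewrite ?size_bits // => H k.
  move=> lt_k; have := H (n - nth 0 ws k).
  rewrite !suffix_count_bits // subKn; last exact: (all_nthP 0 nw).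
  have : k < count (fun x => x <= nth 0 ws k) ws by rewrite count_sorted // lt_k leqnn.
  by move=> h1 /(leq_trans h1); rewrite count_sorted // => /andP[].
rewrite !suffix_count_bits //; set c := count _ us.
rewrite leqNgt count_sorted //; apply/negP => /andP[lt_c le_c].
have := H _ lt_c; rewrite leqNgt => /negP; apply; apply: leq_ltn_trans le_c _.
rewrite ltnNge; apply/negP => h.
have : c < c by rewrite {2}/c count_sorted // h (leq_trans lt_c).
by rewrite ltnn.
Qed.

(** The matching of [slide] on strictly decreasing lists. *)
Fixpoint greedy (vs cs : seq nat) : seq nat :=
  match vs, cs with
  | v :: vs', c :: cs' => if v <= c then c :: greedy vs' cs' else v :: greedy vs' cs
  | _, _ => vs
  end.

(** All entries of cs are taken in the matching. *)
Fixpoint exhausts (vs cs : seq nat) : bool :=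
  match vs, cs with
  | v :: vs', c :: cs' => if v <= c then exhausts vs' cs' else exhausts vs' cs
  | _, _ => nilp cs
  end.

Lemma greedy_nil vs : greedy vs [::] = vs. Proof. by case: vs. Qed.

Lemma mem_greedy vs cs x : x \in greedy vs cs -> (x \in vs) || (x \in cs).
Proof.
elim: vs cs => //= v vs IH [|c cs]; first by rewrite orbF.
case: ifP => _; rewrite !inE => /orP[->|/IH]; rewrite ?orbT //.
  by case/orP=> ->; rewrite ?orbT.
by rewrite inE => /or3P[] ->; rewrite ?orbT.
Qed.

Lemma exhausts_sub vs cs x : exhausts vs cs -> x \in cs -> x \in greedy vs cs.
Proof.
elim: vs cs => [|v vs IH] [|c cs] //=; case: ifP => _ h; rewrite !inE.
  by case/orP=> [->//|/(IH _ h)->]; rewrite orbT.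
by move=> hx; rewrite (IH _ h) ?orbT.
Qed.

Lemma sorted_gtn_all v vs : sorted gtn (v :: vs) = all (gtn v) vs && sorted gtn vs.
Proof.
by rewrite /= path_sortedE // => a b c /= h1 h2; apply: ltn_trans h2 h1.
Qed.

Lemma greedy_sorted vs cs :
  sorted gtn vs -> sorted gtn cs -> sorted gtn (greedy vs cs).
Proof.
elim: vs cs => // v vs IH [|c cs] //.
rewrite !sorted_gtn_all => /andP[av sv] /andP[ac sc] /=.
case: leqP => [le|lt].
  rewrite -/(sorted gtn (c :: _)) sorted_gtn_all IH // andbT.
  apply/allP => x /mem_greedy/orP[xv|xc]; last exact: (allP ac).
  exact: leq_trans (allP av _ xv) le.
rewrite -/(sorted gtn (v :: _)) sorted_gtn_all IH ?sorted_gtn_all ?ac // andbT.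
apply/allP => x /mem_greedy/orP[xv|]; first exact: (allP av).
by rewrite inE => /orP[/eqP->//|xc]; apply: ltn_trans (allP ac _ xc) lt.
Qed.

Lemma bits_above n a s : n < a -> bits n (a :: s) = bits n s.
Proof.
move=> h; apply: eq_bits => t /andP[_ tn]; rewrite inE.
by rewrite (ltn_eqF (leq_ltn_trans tn h)).
Qed.

Lemma top_split n s : sorted gtn s -> all (fun x => x <= n.+1) s ->
  exists s', [/\ sorted gtn s', all (fun x => x <= n) s' &
    s = (if n.+1 \in s then n.+1 :: s' else s')].
Proof.
case: s => [|a s] ; first by exists [::].
rewrite sorted_gtn_all => /andP[aa ss] /= /andP[an sn].
have [e|ne] := eqVneq a n.+1.
  exists s; rewrite inE e eqxx; split=> //; apply/allP => x xs.
  by rewrite -ltnS -e; apply: (allP aa).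
have an' : a <= n by rewrite -ltnS ltn_neqAle ne.
have ms : all (fun x => x <= n) s.
  by apply/allP => x xs; apply: leq_trans (ltnW (allP aa _ xs)) an'.
exists (a :: s); split; rewrite ?sorted_gtn_all ?aa //= ?an' //.
case: ifP => //; rewrite inE eq_sym (negbTE ne) => /(allP ms).
by rewrite ltnn.
Qed.

(** The entries ps of the column exceed n, the largest value still to be read,
    and have not been taken; their number is the counter of [slide]. *)
Lemma bits_greedy_pend n vs ps cs : sorted gtn vs -> sorted gtn cs ->
  all (fun x => x <= n) vs -> all (fun x => x <= n) cs -> all (ltn n) ps ->
  exhausts vs (ps ++ cs) ->
  bits n (greedy vs (ps ++ cs)) = slide (size ps) (bits n vs) (bits n cs).
Proof.
elim: n vs ps cs => // n IH vs ps cs sv sc nv nc np ex.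
have below s : all (fun x => x <= n) s -> n.+1 \notin s.
  by move=> h; apply/negP => /(allP h); rewrite ltnn.
have [vs' [sv' nv' ev]] := top_split sv nv.
have [cs' [sc' nc' ec]] := top_split sc nc.
have nps : n.+1 \notin ps by apply/negP => /(allP np); rewrite /= ltnn.
have np' : all (ltn n) ps by apply: sub_all np => x /= /ltnW.
rewrite /=.
have ebv : bits n vs = bits n vs' by rewrite ev; case: ifP => // _; apply: bits_above.
have ebc : bits n cs = bits n cs' by rewrite ec; case: ifP => // _; apply: bits_above.
rewrite ebv ebc.
(* The value n+1 joins the free entries if it belongs to the column. *)
pose ps' := if n.+1 \in cs then rcons ps n.+1 else ps.
have eps : ps ++ cs = ps' ++ cs'.
  by rewrite /ps' {1}ec; case: ifP => // _; rewrite cat_rcons.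
have szps : size ps' = size ps + (n.+1 \in cs).
  by rewrite /ps'; case: ifP; rewrite ?size_rcons ?addn1 ?addn0.
have nps' : all (ltn n) ps'.
  by rewrite /ps'; case: ifP => // _; rewrite all_rcons np' /= ltnSn.
congr (_ :: _).
  case cin : (n.+1 \in cs) => /=.
    by apply: (exhausts_sub ex); rewrite mem_cat cin orbT.
  case vin : (n.+1 \in vs) => /=; last first.
    by apply/negP => /mem_greedy; rewrite vin mem_cat (negbTE nps) cin.
  rewrite ev vin; case: (ps) nps np => [|p q] /= nps1 np1.
    case: (cs) nc cin => [|c cs0]; first by rewrite mem_head.
    move=> /= /andP[c_n _]; rewrite inE => /negbT/norP[ne _].
    by rewrite ltnNge -ltnS ltn_neqAle eq_sym ne c_n mem_head.
  case/andP: np1 => p_n q_n; rewrite ltnW //= inE.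
  move: nps1; rewrite inE negb_or => /andP[/negbTE-> nq] /=.
  apply/negP => /mem_greedy; rewrite mem_cat (negbTE nq) cin.
  by rewrite (negbTE (below _ nv')).
rewrite eps in ex *.
case vin : (n.+1 \in vs) ev => ev; last first.
  by rewrite -ev in nv' sv' *; rewrite IH // szps subn0 ev.
rewrite ev in ex *; rewrite -szps.
case: (ps') nps' ex => [|p q] nps1 ex; rewrite ?cat0s in ex *.
  have -> : greedy (n.+1 :: vs') cs' = n.+1 :: greedy vs' cs'.
    case: (cs') nc' => [|c cs0] /=; first by rewrite greedy_nil.
    by case/andP=> c_n _; rewrite leqNgt ltnS c_n.
  rewrite bits_above // (IH vs' [::] cs') //; move: ex.
  case: (cs') nc' => [|c cs0] /=; first by case: (vs').
  by case/andP=> c_n _; rewrite leqNgt ltnS c_n.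
case/andP: nps1 => p_n q_n; move: ex; rewrite /= (p_n : n < p) => ex.
by rewrite bits_above // IH // subSS subn0.
Qed.

Lemma bits_greedy n vs cs : sorted gtn vs -> sorted gtn cs ->
  all (fun x => x <= n) vs -> all (fun x => x <= n) cs -> exhausts vs cs ->
  bits n (greedy vs cs) = slide 0 (bits n vs) (bits n cs).
Proof. by move=> *; rewrite -(bits_greedy_pend (ps := [::])). Qed.

Fixpoint coldown (T : nat * nat -> nat) (c k : nat) : seq nat :=
  if k is k'.+1 then T (c, k) :: coldown T c k' else [::].

Lemma mem_coldown T c k t :
  reflect (exists2 r, 0 < r <= k & t = T (c, r)) (t \in coldown T c k).
Proof.
elim: k => [|k IH] /=; first by constructor => -[[]].
rewrite inE; apply: (iffP orP) => [[/eqP->|/IH[r hr ->]]|[r]].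
- by exists k.+1 => //; rewrite ltnS leqnn.
- by exists r => //; case/andP: hr => -> /leqW.
case/andP=> r0; rewrite leq_eqVlt ltnS => /orP[/eqP->|hr] et; first by left; apply/eqP.
by right; apply/IH; exists r => //; rewrite r0.
Qed.

Lemma coldown_rev T c k : rev (coldown T c k) = [seq T (c, r) | r <- iota 1 k].
Proof.
by elim: k => //= k IH; rewrite rev_cons IH -map_rcons -cats1 -(iotaD 1 k 1) addn1.
Qed.

Section ScanBits.
Variables (lam : seq nat) (T : nat * nat -> nat) (n : nat).
Notation z := (collen lam).
Notation L := (rowlen lam 1).
Hypothesis lam_sorted : sorted geq lam.
Hypothesis T_col : forall c r, 0 < c -> 0 < r < z c -> T (c, r) < T (c, r.+1).
Hypothesis T_row : forall c r, 0 < c -> 0 < r <= z c.+1 -> T (c, r) <= T (c.+1, r).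
Hypothesis T_bound : forall c r, 0 < c -> 0 < r <= z c -> T (c, r) <= n.

Definition column c := coldown T c (z c).

Definition columns := [seq bits n (column c) | c <- itv 1 L].

Lemma coldown_sorted c k : 0 < c -> k <= z c -> sorted gtn (coldown T c k).
Proof.
move=> c0; elim: k => // -[|k] IH h //.
have := IH (ltnW h); rewrite /= => ->.
by rewrite T_col.
Qed.

Lemma coldown_bound c k : 0 < c -> k <= z c ->
  all (fun x => x <= n) (coldown T c k).
Proof.
move=> c0 h; apply/allP => x /mem_coldown[r /andP[r0 rk] ->].
by apply: T_bound; rewrite // r0 (leq_trans rk).
Qed.

(** The values after column c of the paths from column l, without the first d
    of them, in the order in which the paths are removed. *)
Definition front l c d :=
  [seq value T (height lam T l d') c | d' <- iota d (z l - d)].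

(** Exchanges the order of the two recursions, over paths and over columns: at
    path d, either the head of the column list is taken and the height drops by
    one, or both stay the same.  The column is exhausted because nothing is left
    after the last path. *)
Lemma front_step l c d : 0 < l <= c ->
  let cs := coldown T c.+1 (height lam T l d c.+1) in
  greedy (front l c d) cs = front l c.+1 d /\ exhausts (front l c d) cs.
Proof.
move=> hlc; have hlc' : 0 < l <= c.+1 by case/andP: hlc => -> /leqW.
rewrite /front; move e : (z l - d) => m.
elim: m d e => [|m IH] d e.
  suff -> : height lam T l d c.+1 = 0 by [].
  apply/eqP; rewrite -leqn0 -(height_end T_row hlc').
  by apply: height_anti; lia.
have [|IH1 IH2] := IH d.+1; first by lia.
rewrite [iota d m.+1]/= !map_cons valueS.
set F := [seq _ | _ <- _] in IH1 IH2 *; set G := [seq _ | _ <- _] in IH1 *.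
move: IH1 IH2; rewrite [height _ _ _ d.+1 _]/= /taken -[c.+1.-1]/c.
case eh : (height lam T l d c.+1) => [|k] /=.
  by rewrite greedy_nil => -> _.
by case: ifP => _ /=; rewrite ?subn1 ?subn0 /= => -> ->.
Qed.

Lemma front_first l d : 0 < l -> front l l d = coldown T l (z l - d).
Proof.
move=> l0; rewrite /front; move e : (z l - d) => m.
elim: m d e => //= m IH d e; rewrite IH; last by lia.
congr (_ :: _); have := taken_first lam T d l0.
case: l l0 e {IH} => // l l0 e; rewrite valueS => ->.
by rewrite height_first // e.
Qed.

Lemma front_bits l c : 0 < l <= c -> [/\ sorted gtn (front l c 0),
  all (fun x => x <= n) (front l c 0) &
  bits n (front l c 0) =
    foldl (slide 0) (bits n (column l)) [seq bits n (column b) | b <- iota l.+1 (c - l)]].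
Proof.
move=> /andP[l0 /subnKC<-]; elim: (c - l) => [|k [IH1 IH2 IH3]].
  rewrite addn0 subnn front_first // subn0; split=> //.
    exact: coldown_sorted.
  exact: coldown_bound.
have hlk : 0 < l <= l + k by rewrite l0 leq_addr.
have := front_step 0 hlk; rewrite /= leqW ?leq_addr // -addnS.
move=> [<- ex].
have c0 : 0 < l + k.+1 by rewrite addnS.
split.
- apply: greedy_sorted IH1 _; exact: coldown_sorted.
- apply/allP => x /mem_greedy/orP[/(allP IH2)//|].
  by move: x; apply/allP; apply: coldown_bound.
rewrite bits_greedy //; [|exact: coldown_sorted|exact: coldown_bound].
have -> : l + k.+1 - l = k + 1 by lia.
by rewrite IH3 addKn iotaD map_cat foldl_cat /= addSn addnS.
Qed.

Lemma Phi_columns l : l < L ->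
  Phi (drop l columns) = bits n (front l.+1 L 0).
Proof.
move=> lL; have [|_ _ ->] := @front_bits l.+1 L; first by [].
rewrite /columns -map_drop /itv /index_iota subn1 /= drop_iota.
by rewrite add1n -(subnSK lL).
Qed.

Hypothesis T_pos : forall c r, 0 < c -> 0 < r <= z c -> 0 < T (c, r).

Lemma front_rev l c k : k < z l ->
  nth 0 (rev (front l c 0)) k = value T (height lam T l (z l - k.+1)) c.
Proof.
move=> lt_k; rewrite nth_rev size_map size_iota subn0 //.
by rewrite (nth_map 0) ?size_iota ?nth_iota //; lia.
Qed.

Lemma front_pos l c : 0 < l <= c -> c <= L -> all (leq 1) (front l c 0).
Proof.
move=> /andP[l0 lc] cL; apply/allP => x /mapP[d].
rewrite mem_iota subn0 add0n /= => hd ->.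
apply: leq_trans (value_mono _ _ lc).
have -> : value T (height lam T l d) l = T (l, z l - d).
  have := taken_first lam T d l0; rewrite height_first //.
  case: l l0 {lc} hd => // l l0 hd.
  by rewrite valueS subn_gt0 => ->; rewrite hd height_first.
by apply: T_pos; rewrite // leq_subr subn_gt0 hd.
Qed.

Lemma bits_rev m s : bits m (rev s) = bits m s.
Proof. by apply: eq_bits => t _; rewrite mem_rev. Qed.

Lemma dom_scan l ws : l < L -> sorted ltn ws -> size ws = z l.+1 ->
  all (leq 1) ws -> all (fun x => x <= n) ws ->
  reflect (forall k, 0 < k <= z l.+1 -> scan_value lam T l.+1 k <= nth 0 ws k.-1)
    (dom (Phi (drop l columns)) (bits n ws)).
Proof.
move=> lL sws zws pws nws; rewrite Phi_columns // -bits_rev.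
have hl : 0 < l.+1 <= L by [].
have [sf nf _] := front_bits hl.
have szf : size (rev (front l.+1 L 0)) = z l.+1.
  by rewrite size_rev size_map size_iota subn0.
apply: (iffP (dom_bits _ sws _ pws nws _)); rewrite ?szf ?zws //.
- by rewrite rev_sorted.
- by rewrite all_rev front_pos.
- by move=> H [|k] //= hk; rewrite /scan_value -front_rev //; apply: H; rewrite ?zws.
- by move=> H k; rewrite ?zws => hk; rewrite front_rev //; apply: (H k.+1).
Qed.
End ScanBits.

(** * Tableaux as sequences of columns *)

Definition ones (n : nat) (C : seq bool) : seq nat :=
  [seq t <- iota 1 n | nth false C (n - t)].

Lemma mem_ones n C t : (t \in ones n C) = nth false C (n - t) && (0 < t <= n).
Proof. by rewrite mem_filter mem_iota add1n ltnS. Qed.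

Lemma ones_sorted n C : sorted ltn (ones n C).
Proof. exact: sorted_filter ltn_trans _ _ (iota_ltn_sorted _ _). Qed.

Lemma ones_pos n C : all (leq 1) (ones n C).
Proof. by apply/allP => t; rewrite mem_ones => /and3P[]. Qed.

Lemma ones_bound n C : all (fun x => x <= n) (ones n C).
Proof. by apply/allP => t; rewrite mem_ones => /and3P[]. Qed.

Lemma bits_ones n C : size C = n -> bits n (ones n C) = C.
Proof.
move=> zC; apply: (@eq_from_nth _ false); rewrite size_bits // => k lt_k.
rewrite nth_bits // mem_ones subKn; last exact: ltnW.
by rewrite subn_gt0 lt_k leq_subr !andbT.
Qed.

Lemma size_ones n C : size C = n -> size (ones n C) = count id C.
Proof.
move=> zC; rewrite -{2}(bits_ones zC) count_bits ?ones_pos //.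
  by apply/esym/eqP; rewrite -all_count ones_bound.
by apply: (sorted_uniq ltn_trans ltnn); apply: ones_sorted.
Qed.

Lemma ones_bits n s : sorted ltn s -> all (leq 1) s -> all (fun x => x <= n) s ->
  ones n (bits n s) = s.
Proof.
move=> ss ps ns; apply: (irr_sorted_eq ltn_trans ltnn) => //.
  exact: ones_sorted.
move=> t; rewrite mem_ones; apply/andP/idP => [[]|ts].
  by move=> h /andP[t0 tn]; move: h; rewrite nth_bits ?subKn //; lia.
have t0 : 0 < t := allP ps _ ts; have tn : t <= n := allP ns _ ts.
by rewrite nth_bits ?subKn ?t0 ?tn //; lia.
Qed.

Section Fillings.
Variables (n : nat) (lam : seq nat).
Hypothesis lam_sorted : sorted geq lam.
Notation z := (collen lam).
Notation L := (rowlen lam 1).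
Implicit Types (T : filling n lam).

Lemma entry_cell T (c : seq_sub (cells lam)) : entry T (val c) = (T c).+1.
Proof. by rewrite /entry valK. Qed.

Lemma entry_out T c : c \notin cells lam -> entry T c = 0.
Proof. by move=> h; rewrite /entry insubN. Qed.

Lemma cellP j i : 0 < j -> 0 < i <= z j -> (j, i) \in cells lam.
Proof.
by move=> j0 hi; rewrite mem_cells j0 hi (le_first_row lam_sorted j0 hi).
Qed.

Lemma entry_bound T c r : 0 < c -> 0 < r <= z c -> entry T (c, r) <= n.
Proof.
move=> c0 hr; rewrite /entry; case: insubP => // u _ _; exact: ltn_ord.
Qed.

Lemma entry_pos T c r : 0 < c -> 0 < r <= z c -> 0 < entry T (c, r).
Proof.
by move=> c0 hr; rewrite /entry insubT //; apply: cellP.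
Qed.

Lemma entry00 T : entry T (0, 0) = 0.
Proof. by rewrite entry_out // mem_cells. Qed.

Lemma semistandardP T : reflect
  ((forall c r, 0 < c -> 0 < r < z c -> entry T (c, r) < entry T (c, r.+1)) /\
   (forall c r, 0 < c -> 0 < r <= z c.+1 -> entry T (c, r) <= entry T (c.+1, r)))
  (semistandard T).
Proof.
apply: (iffP allP) => [H|[Hc Hr] [j i]].
  split=> c r c0 hr.
    have cc : (c, r) \in cells lam by apply: cellP => //; case/andP: hr => -> /ltnW.
    have /andP[_] := H _ cc; rewrite /= (cellP (i := r.+1)) //.
    by case/andP: hr.
  have cc : (c, r) \in cells lam.
    apply: cellP => //; case/andP: hr => -> h /=.
    exact: leq_trans h (collen_anti _ _).
  by have /andP[+ _] := H _ cc; rewrite /= (cellP (j := c.+1)).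
rewrite mem_cells => /andP[/andP[j0 _] /andP[i0 _]] /=; apply/andP; split.
  apply/implyP; rewrite mem_cells => /andP[_ h]; exact: Hr.
by apply/implyP; rewrite mem_cells => /andP[_ h]; apply: Hc; rewrite // i0.
Qed.

Definition colseq T := columns lam (entry T) n.

Lemma colseq_size T : size (colseq T) = L.
Proof. by rewrite size_map /itv /index_iota subn1 size_iota. Qed.

Lemma nth_colseq T l : l < L ->
  nth [::] (colseq T) l = bits n (column lam (entry T) l.+1).
Proof.
move=> h; rewrite (nth_map 0) ?nth_iota /itv /index_iota ?subn1 ?size_iota //.
Qed.

(** The sequences of columns of semistandard tableaux, described without
    reference to fillings: the form in which stability under the crystal
    operators is proved. *)
Definition tabseq (cs : seq (seq bool)) :=
  [&& sized n cs, [seq count id C | C <- cs] == [seq z j | j <- itv 1 L]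
    & sorted dom cs].

Definition asc T c := [seq entry T (c, r) | r <- iota 1 (z c)].

Lemma column_asc T c : bits n (column lam (entry T) c) = bits n (asc T c).
Proof. by rewrite -bits_rev /column coldown_rev. Qed.

Lemma nth_asc T c k : k < z c -> nth 0 (asc T c) k = entry T (c, k.+1).
Proof. by move=> h; rewrite (nth_map 0) ?size_iota // nth_iota. Qed.

Lemma size_asc T c : size (asc T c) = z c.
Proof. by rewrite size_map size_iota. Qed.

Lemma asc_facts T c : semistandard T -> 0 < c ->
  [/\ sorted ltn (asc T c), all (leq 1) (asc T c) & all (fun x => x <= n) (asc T c)].
Proof.
move=> /semistandardP[Tc Tr] c0; split.
- apply/(sortedP 0) => k; rewrite size_asc => h.
  by rewrite !nth_asc ?(ltnW h) //; apply: Tc.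
- apply/allP => x /mapP[r]; rewrite mem_iota add1n ltnS => hr ->; exact: entry_pos.
- apply/allP => x /mapP[r]; rewrite mem_iota add1n ltnS => hr ->; exact: entry_bound.
Qed.

Lemma colseq_tabseq T : semistandard T -> tabseq (colseq T).
Proof.
move=> sT; have /semistandardP[Tc Tr] := sT; apply/and3P; split.
- by apply/allP => C /mapP[c _ ->]; rewrite size_bits.
- rewrite -map_comp; apply/eqP/eq_in_map => c; rewrite mem_itv => /andP[c0 _] /=.
  have [s1 s2 s3] := asc_facts sT c0.
  rewrite column_asc count_bits ?(sorted_uniq ltn_trans ltnn s1) //.
  by apply/eqP; move: s3; rewrite all_count size_asc.
apply/(sortedP [::]) => k; rewrite colseq_size => h.
rewrite !nth_colseq ?(ltnW h) // !column_asc.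
have [s1 s2 s3] := asc_facts sT (ltn0Sn k).
have [s1' s2' s3'] := asc_facts sT (ltn0Sn k.+1).
apply/dom_bits; rewrite ?size_asc //; first exact: collen_anti.
move=> i hi; rewrite !nth_asc //; first exact: Tr.
exact: leq_trans hi (collen_anti _ (leqnSn _)).
Qed.

Lemma colseq_inj T T' : semistandard T -> semistandard T' ->
  colseq T = colseq T' -> T = T'.
Proof.
move=> sT sT' e; apply/ffunP => c; apply: val_inj; apply: succn_inj.
rewrite /= -!entry_cell.
case: c => -[j i] /= hc; have := hc.
rewrite mem_cells => /andP[/andP[j0 jL] /andP[i0 iz]].
have hj : j.-1 < L by rewrite prednK.
have := congr1 (fun cs => nth [::] cs j.-1) e.
rewrite !nth_colseq // prednK // !column_asc.
have [s1 s2 s3] := asc_facts sT j0; have [s1' s2' s3'] := asc_facts sT' j0.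
move=> /(congr1 (ones n)); rewrite !ones_bits // => /(congr1 (fun s => nth 0 s i.-1)).
by rewrite !nth_asc ?prednK.
Qed.

(** The column of T is the increasing list of the values whose bits are set. *)
Lemma tabseq_colseq cs : 0 < n -> tabseq cs ->
  exists2 T, semistandard T & colseq T = cs.
Proof.
move=> n0 /and3P[/allP zc /eqP ec srt].
have zcs : size cs = L.
  by have := congr1 size ec; rewrite !size_map /itv /index_iota subn1 size_iota.
pose o j := ones n (nth [::] cs j.-1).
have hC j : 0 < j <= L -> nth [::] cs j.-1 \in cs.
  by move=> /andP[j0 jL]; rewrite mem_nth // zcs prednK.
have so j : 0 < j <= L -> size (o j) = z j.
  move=> hj; rewrite size_ones; last by apply/eqP/zc/hC.
  have := congr1 (fun s => nth 0 s j.-1) ec.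
  case/andP: (hj) => j0 jL.
  rewrite (nth_map [::]) ?zcs ?prednK // => ->.
  rewrite (nth_map 0) /itv /index_iota subn1 ?size_iota ?nth_iota ?prednK //=.
  by rewrite add1n prednK.
pose v (c : nat * nat) := nth 0 (o c.1) c.2.-1.
have vb c : c \in cells lam -> 0 < v c <= n.
  case: c => j i; rewrite mem_cells => /andP[hj /andP[i0 iz]].
  have : v (j, i) \in o j by rewrite mem_nth // so // prednK.
  by rewrite mem_ones => /andP[].
pose T : filling n lam := [ffun c => insubd (Ordinal n0) (v (val c)).-1].
have eT c : c \in cells lam -> entry T c = v c.
  move=> hc; rewrite /entry insubT ffunE val_insubd /=.
  by have /andP[v0 vn] := vb c hc; rewrite prednK // vn prednK.
have sT : semistandard T.
  apply/semistandardP; split=> c r c0 hr; have [r0 rz] := andP hr.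
    have h1 : (c, r.+1) \in cells lam by apply: cellP.
    have h2 : (c, r) \in cells lam by apply: cellP; rewrite // r0 ltnW.
    have hc : 0 < c <= L by move: h1; rewrite mem_cells => /andP[].
    rewrite !eT // /v /=; have /sortedP := ones_sorted n (nth [::] cs c.-1).
    by move=> /(_ 0 r.-1); rewrite prednK // -/(o c) so //; apply.
  have h1 : (c.+1, r) \in cells lam by apply: cellP.
  have hrc : 0 < r <= z c by rewrite r0 (leq_trans rz) // collen_anti.
  have h2 : (c, r) \in cells lam by apply: cellP.
  have hc : 0 < c <= L by move: h2; rewrite mem_cells => /andP[].
  have hc' : 0 < c.+1 <= L by move: h1; rewrite mem_cells => /andP[].
  rewrite !eT // /v /=; have /sortedP := srt.
  move=> /(_ [::] c.-1); rewrite prednK // zcs => /(_ hc').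
  have zC : size (nth [::] cs c.-1) = n by apply/eqP/zc/hC.
  have zC' : size (nth [::] cs c) = n by apply/eqP/zc/(hC c.+1).
  rewrite -(bits_ones zC) -(bits_ones zC').
  have le : size (o c.+1) <= size (o c) by rewrite !so // collen_anti.
  move=> /(dom_bits (ones_sorted _ _) (ones_sorted _ _) (ones_pos _ _)
    (ones_pos _ _) (ones_bound _ _) le) /(_ r.-1).
  by rewrite -/(o c.+1) so // prednK //; apply.
exists T => //; apply: (@eq_from_nth _ [::]); rewrite colseq_size ?zcs // => l lL.
have hl : 0 < l.+1 <= L by [].
rewrite nth_colseq // column_asc.
have zC : size (nth [::] cs l) = n by apply/eqP/zc/(hC l.+1).
rewrite -[RHS](bits_ones zC); congr (bits n _).
apply: (@eq_from_nth _ 0); rewrite size_asc; first by rewrite -/(o l.+1) so.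
by move=> k hk; rewrite nth_asc // eT // mem_cells hl.
Qed.

Lemma uniq_cells : uniq (cells lam).
Proof.
apply: allpairs_uniq_dep => [|j _|]; [exact: iota_uniq|exact: iota_uniq|].
by move=> [a b] [c d] /= _ _ [-> ->].
Qed.

(** A value occurs at most once in a column. *)
Lemma card_value T (t : 'I_n) : semistandard T ->
  #|[set c | T c == t]| = bit_count (n.-1 - t) (colseq T).
Proof.
move=> sT.
have -> : #|[set c | T c == t]| = count (fun c => entry T c == t.+1) (cells lam).
  rewrite -size_filter cardE -(size_map val); apply/perm_size/uniq_perm.
  - by rewrite map_inj_uniq ?enum_uniq //; apply: val_inj.
  - exact/filter_uniq/uniq_cells.
  move=> c; rewrite mem_filter; apply/mapP/andP => [[u]|[/eqP ec hc]].
    by rewrite mem_enum inE => /eqP e ->; rewrite entry_cell e; split=> //; apply: valP.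
  exists (Sub c hc); last by rewrite SubK.
  rewrite mem_enum inE; apply/eqP/val_inj/succn_inj => /=.
  by rewrite -ec -entry_cell SubK.
rewrite /cells count_flatten sumnE !big_map /bit_count /colseq /columns.
rewrite count_map -sum1_count.
rewrite [RHS]big_mkcond /=.
rewrite big_seq [RHS]big_seq; apply: eq_bigr => j; rewrite mem_itv => /andP[j0 jL].
rewrite column_asc nth_bits; last by have := ltn_ord t; lia.
have -> : n - (n.-1 - t) = t.+1 by have := ltn_ord t; lia.
have [s1 _ _] := asc_facts sT j0.
transitivity (count_mem t.+1 (asc T j)).
  by rewrite !count_map /itv /index_iota subn1.
by rewrite count_uniq_mem ?(sorted_uniq ltn_trans ltnn s1) //; case: (_ \in _).
Qed.

Lemma weight_cweight T : semistandard T -> weight T = cweight n (colseq T).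
Proof. by move=> sT; apply: eq_bigr => t _; rewrite card_value. Qed.

Definition tabseqs := [seq colseq T | T <- enum (@semistandard n lam)].

Lemma tabseqs_uniq : uniq tabseqs.
Proof.
rewrite map_inj_in_uniq ?enum_uniq // => T T'; rewrite !mem_enum => sT sT'.
exact: colseq_inj.
Qed.

Lemma mem_tabseqs cs : 0 < n -> (cs \in tabseqs) = tabseq cs.
Proof.
move=> n0; apply/mapP/idP => [[T]|].
  by rewrite mem_enum => sT ->; apply: colseq_tabseq.
by move=> /(tabseq_colseq n0)[T sT <-]; exists T; rewrite ?mem_enum.
Qed.

Lemma sum_tabseqs (p : pred (seq (seq bool))) :
  (\sum_(T : filling n lam | semistandard T && p (colseq T)) weight T =
   \sum_(cs <- tabseqs | p cs) cweight n cs)%R.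
Proof.
rewrite /tabseqs big_map big_enum_cond /=; apply: eq_bigr => T /andP[sT _].
exact: weight_cweight.
Qed.
End Fillings.

(** * Reduced compositions *)

Section Words.
Variable n : nat.
Implicit Types (w : seq 'I_n.-1) (g : 'S_n) (i : 'I_n.-1).

Lemma stransp_inversion i (x y : 'I_n) :
  x < y -> stransp i y < stransp i x -> x = lo i /\ y = hi i.
Proof.
rewrite /stransp; case: tpermP => [->|->|] /=; case: tpermP => [->|->|] //=.
all: by move=> *; lia.
Qed.

Lemma tperm_mul g (a b : 'I_n) : (tperm a b * g = g * tperm (g a) (g b))%g.
Proof. by rewrite -tpermJ conjgE mulKVg. Qed.

(** Two values that are finally out of order are exchanged by some letter of
    the word; deleting this letter multiplies the result by the transposition of
    their positions. *)
Lemma exchange w (a b : 'I_n) : a < b -> word_act w b < word_act w a ->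
  exists2 w', size w' < size w & word_act w' = (tperm a b * word_act w)%g.
Proof.
move=> lt_ab; elim: w => [|i w IH] /=; first by rewrite !perm1; lia.
rewrite /sact !permM => lt_s.
have [lt_w|ge_w] := ltnP (word_act w b) (word_act w a).
  have [w' sw' ew'] := IH lt_w; exists (i :: w') => //=.
  by rewrite /sact ew' mulgA.
have lt_w : word_act w a < word_act w b.
  rewrite ltn_neqAle ge_w andbT; apply/eqP => /val_inj/perm_inj e.
  by rewrite e ltnn in lt_ab.
have [ea eb] := stransp_inversion lt_w lt_s.
by exists w => //; rewrite mulgA tperm_mul ea eb -mulgA tperm2 mulg1.
Qed.

(** If i+1 came before i, the new letter would undo an inversion, and the
    exchange property would give a shorter word. *)
Lemma reduced_cons i w g : reduced_composition g (i :: w) ->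
  reduced_composition (word_act w) w /\
  ((word_act w)^-1 (lo i) < (word_act w)^-1 (hi i))%g.
Proof.
move=> [/= <- min_w]; split.
  split=> // w' ew'; have := min_w (i :: w').
  by rewrite /= ew' => /(_ erefl).
rewrite ltnNge leq_eqVlt; apply/norP; split.
  apply/eqP => /val_inj/perm_inj/eqP; apply/negP.
  by rewrite eq_sym lo_neq_hi.
apply/negP => lt_ba; have := @exchange w _ _ lt_ba.
rewrite !permKV /= => /(_ (ltnSn _))[w' sw' ew'].
have := min_w w'; rewrite ew' tperm_mul !permKV tpermC => /(_ erefl).
by rewrite leqNgt ltnS ltnW.
Qed.
End Words.

(** * Columns of keys *)

Section KeyBits.
Variables (n : nat) (lam : seq nat).
Hypothesis lam_sorted : sorted geq lam.
Hypothesis lam_n : size lam = n.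
Notation z := (collen lam).
Notation L := (rowlen lam 1).
Implicit Types (pi : 'S_n) (T : filling n lam).

Definition key_bits pi := [seq bits n (take (z j) (one_line pi)) | j <- itv 1 L].

Lemma size_key_bits pi : size (key_bits pi) = L.
Proof. by rewrite size_map /itv /index_iota subn1 size_iota. Qed.

Lemma nth_key_bits pi l : l < L ->
  nth [::] (key_bits pi) l = bits n (take (z l.+1) (one_line pi)).
Proof.
by move=> h; rewrite (nth_map 0) /itv /index_iota subn1 ?size_iota ?nth_iota.
Qed.

Lemma mem_take_one_line pi k (x : 'I_n) :
  (x.+1 \in take k (one_line pi)) = ((pi^-1)%g x < k).
Proof.
rewrite -map_take; apply/mapP/idP => [[y hy [/val_inj->]]|lt_k].
  rewrite permK; have := map_f val hy.
  by rewrite map_take val_enum_ord take_iota mem_iota add0n leq_min => /and3P[].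
exists ((pi^-1)%g x); last by rewrite permKV.
rewrite -(mem_map val_inj) map_take val_enum_ord take_iota mem_iota add0n /=.
by rewrite leq_min lt_k ltn_ord.
Qed.

Lemma nth_take_bits pi j k (x : 'I_n) : k + x = n.-1 ->
  nth false (bits n (take j (one_line pi))) k = ((pi^-1)%g x < j).
Proof.
move=> e; rewrite nth_bits; last by have := ltn_ord x; lia.
rewrite -mem_take_one_line (_ : n - k = x.+1) //.
by have := ltn_ord x; lia.
Qed.

Section Simple.
Variable i : 'I_n.-1.
Let r := n - i - 2.

Lemma pos_hi : r + hi i = n.-1.
Proof. by have := ltn_ord i; rewrite /r /=; lia. Qed.

Lemma pos_lo : r.+1 + lo i = n.-1.
Proof. by have := ltn_ord i; rewrite /r /=; lia. Qed.

Lemma sw_key_bits pi j :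
  bits n (take j (one_line (sact i pi))) = sw r (bits n (take j (one_line pi))).
Proof.
have hC : r.+1 < size (bits n (take j (one_line pi))).
  by rewrite size_bits swap_pos_lt.
apply: (@eq_from_nth _ false); first by rewrite (sw_size hC) !size_bits.
rewrite size_bits => k lt_k.
have [x e] : exists x : 'I_n, k + x = n.-1.
  have hx : n.-1 - k < n by lia.
  by exists (Ordinal hx) => /=; lia.
have einv (y : 'I_n) : ((sact i pi)^-1 y = pi^-1 (stransp i y))%g.
  by rewrite /sact /stransp invMg permM tpermV.
have [eh el] := sw_bits hC.
have := nth_take_bits pi j pos_hi; have := nth_take_bits pi j pos_lo.
rewrite -/(lo_bit r _) -/(hi_bit r _) => elo ehi.
rewrite (nth_take_bits _ _ e) einv.
have /= hhi := pos_hi; have /= hlo := pos_lo.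
have [ek|ne1] := eqVneq k r.
  have -> : x = hi i by apply: ord_inj => /=; lia.
  by rewrite ek eh elo tpermR.
have [ek|ne2] := eqVneq k r.+1.
  have -> : x = lo i by apply: ord_inj => /=; lia.
  by rewrite ek el ehi tpermL.
rewrite nth_sw // (nth_take_bits _ _ e) tpermD // -val_eqE /=; lia.
Qed.

Lemma key_bits_sact pi : key_bits (sact i pi) = map (sw r) (key_bits pi).
Proof. by rewrite -map_comp; apply: eq_map => j /=; rewrite sw_key_bits. Qed.

Lemma key_bits_minus pi l : ((pi^-1) (lo i) < (pi^-1) (hi i))%g -> l < L ->
  ~~ minus r (nth [::] (key_bits pi) l).
Proof.
move=> lt_pi lL; rewrite nth_key_bits // /minus /hi_bit /lo_bit.
rewrite (nth_take_bits _ _ pos_hi) (nth_take_bits _ _ pos_lo) negb_and negbK -implybE.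
by apply/implyP; apply: ltn_trans.
Qed.

Lemma tabseq_flip_plus cs : tabseq n lam cs -> 0 < free_plus r cs ->
  tabseq n lam (flip r (plus r) cs).
Proof.
have hr : r.+1 < n := swap_pos_lt i.
move=> /and3P[zc hc srt] u0; have [X [C [Z [e pC pv]]]] := plus_pivot u0.
rewrite e in zc hc srt *; rewrite flip_plus //.
have [zX zC zZ] := and3P (etrans (esym (sized_cat _ _ _ _)) zc).
have hC := size_hr hr zC.
apply/and3P; split.
- by rewrite sized_cat zX zZ sw_size // zC.
- by rewrite -(eqP hc) !map_cat /= count_sw.
exact: sorted_flip_plus hr _ _ _ zc pC pv srt.
Qed.

Lemma tabseq_flip_minus cs : tabseq n lam cs -> 0 < free_minus r cs ->
  tabseq n lam (flip r (minus r) cs).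
Proof.
have hr : r.+1 < n := swap_pos_lt i.
move=> /and3P[zc hc srt] u0; have [X [C [Z [e mC pv]]]] := minus_pivot u0.
rewrite e in zc hc srt *; rewrite flip_minus //.
have [zX zC zZ] := and3P (etrans (esym (sized_cat _ _ _ _)) zc).
have hC := size_hr hr zC.
apply/and3P; split.
- by rewrite sized_cat zX zZ sw_size // zC.
- by rewrite -(eqP hc) !map_cat /= count_sw.
exact: sorted_flip_minus hr _ _ _ zc mC pv srt.
Qed.
End Simple.

Lemma one_line_uniq pi : uniq (one_line pi).
Proof.
by rewrite map_inj_uniq ?enum_uniq // => x y [] /val_inj/perm_inj.
Qed.

Lemma key_le_scan T pi : semistandard T -> key_le (key_bits pi) (colseq T) =
  all (fun c => scan_value lam (entry T) c.1 c.2 <= key lam pi c) (cells lam).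
Proof.
move=> sT; have /(semistandardP lam_sorted)[Tc Tr] := sT.
have Tb := @entry_bound n lam T; have Tp := entry_pos lam_sorted T.
have ws_dom l : l < L -> reflect (forall k, 0 < k <= z l.+1 ->
    scan_value lam (entry T) l.+1 k <= key lam pi (l.+1, k))
    (dom (Phi (drop l (colseq T))) (nth [::] (key_bits pi) l)).
  move=> lL; rewrite nth_key_bits //.
  set s := take _ _; have -> : bits n s = bits n (sort leq s).
    by apply: eq_bits => t _; rewrite mem_sort.
  have us : uniq s by apply: take_uniq (one_line_uniq _).
  have bs t : t \in s -> 0 < t <= n.
    by move=> /mem_take/mapP[y _ ->]; rewrite ltn_ord.
  apply: (dom_scan lam_sorted Tc Tr Tb Tp (ws := sort leq s)) => //.
  - by rewrite ltn_sorted_uniq_leq sort_uniq us sort_sorted //; apply: leq_total.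
  - by rewrite size_sort size_takel // size_one_line collen_n.
  - by apply/allP => t; rewrite mem_sort => /bs/andP[].
  - by apply/allP => t; rewrite mem_sort => /bs/andP[].
apply/allP/allP => [H [j i]|H l].
  rewrite mem_cells => /andP[/andP[j0 jL] hi] /=.
  have hj : j.-1 < L by rewrite prednK.
  have := H j.-1; rewrite mem_iota colseq_size hj => /(_ isT)/(ws_dom _ hj).
  by rewrite prednK //; apply.
rewrite mem_iota colseq_size => lL; apply/(ws_dom _ lL) => k hk.
by apply: (H (l.+1, k)); rewrite mem_cells hk andbT.
Qed.

Lemma condA_key_le T pi : semistandard T ->
  condA pi T = key_le (key_bits pi) (colseq T).
Proof.
move=> sT; have /(semistandardP lam_sorted)[Tc Tr] := sT.
have Tb := @entry_bound n lam T; have Tp := entry_pos lam_sorted T.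
by rewrite key_le_scan //; apply: eq_in_all => -[j i] hc; apply: setAE.
Qed.

Lemma condB_key_le T pi : semistandard T ->
  condB pi T = key_le (key_bits pi) (colseq T).
Proof.
move=> sT; have /(semistandardP lam_sorted)[Tc Tr] := sT.
have Tb := @entry_bound n lam T; have Tp := entry_pos lam_sorted T.
rewrite key_le_scan //; apply/allP/allP => H [j i] hc.
  by apply: (scan_setB _ _ _ _ (pi := pi)) hc => //; [exact: entry00].
by apply: setB_scan => //; [exact: entry00|move=> j' i' hc'; apply: (H (j', i'))].
Qed.

End KeyBits.

(** * The identity permutation *)

Section Base.
Variables (n : nat) (lam : n.-tuple nat).
Hypothesis lam_sorted : sorted geq lam.
Notation z := (collen lam).
Notation L := (rowlen lam 1).
Implicit Types T : filling n lam.

Lemma one_line1 : one_line (1 : 'S_n)%g = iota 1 n.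
Proof.
rewrite /one_line (eq_map (g := succn \o val)); last by move=> x /=; rewrite perm1.
by rewrite map_comp val_enum_ord -(iotaDl 1 0).
Qed.

Lemma key1 j i : (j, i) \in cells lam -> key lam (1 : 'S_n)%g (j, i) = i.
Proof.
rewrite mem_cells => /andP[/andP[j0 jL] /andP[i0 iz]].
rewrite /key one_line1 take_iota sorted_sort ?iota_sorted //; last exact: leq_trans.
have zn : z j <= n by rewrite (collen_n (size_tuple lam)).
by rewrite (minn_idPl zn) nth_iota ?prednK // add1n prednK.
Qed.

(** S is at least T and T(j,i) is at least i, so the bound forces equality.
    Conversely, what is left before the i-th path from column j has at most i
    rows. *)
Lemma key_le1 T : semistandard T ->
  key_le (key_bits lam (1 : 'S_n)%g) (colseq T) =
  all (fun c => entry T c == c.2) (cells lam).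
Proof.
move=> sT; have /(semistandardP lam_sorted)[Tc Tr] := sT.
have Tp := entry_pos lam_sorted T.
rewrite (key_le_scan lam_sorted (size_tuple lam)) //.
apply/allP/allP => H [j i] hc; have := hc;
  rewrite mem_cells => /andP[/andP[j0 jL] hi] /=.
  have := H _ hc; rewrite key1 //= => le_i.
  rewrite eqn_leq (T_ge_row Tc Tp) // andbT; apply: leq_trans le_i.
  have ehl : height lam (entry T) j (z j - i) j = i.
    by rewrite height_first // subKn //; case/andP: hi.
  have /value_leP := leqnn (scan_value lam (entry T) j i); move/(_ j).
  by rewrite ehl j0 jL; apply=> //; case/andP: hi.
rewrite key1 //; apply/value_leP => a /andP[a0 aL] h0.
have aj : 0 < j <= a.
  by rewrite j0 leqNgt; apply/negP => lt_a; rewrite height_left in h0.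
rewrite (eqP (H (a, _) _)) /=; last by rewrite mem_cells a0 aL h0 height_le.
apply: leq_trans (height_shape_le Tr _ aj) _.
by rewrite height_first // subKn //; case/andP: hi.
Qed.

Lemma demazure_id :
  (\prod_(i < n) 'X_i ^+ tnth lam i : {mpoly int[n]})%R =
  (\sum_(T : filling n lam |
     semistandard T && key_le (key_bits lam (1 : 'S_n)%g) (colseq T)) weight T)%R.
Proof.
have rb (c : seq_sub (cells lam)) : (val c).2.-1 < n.
  have := valP c; case: (val c) => j i /=; rewrite mem_cells => /andP[_ /andP[i0 iz]].
  by rewrite prednK // (leq_trans iz) // (collen_n (size_tuple lam)).
pose T0 : filling n lam := [ffun c => Ordinal (rb c)].
have e0 c : c \in cells lam -> entry T0 c = c.2.
  case: c => j i hc; rewrite /entry insubT ffunE /= prednK //.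
  by move: hc; rewrite mem_cells => /andP[_ /andP[]].
have s0 : semistandard T0.
  apply/(semistandardP lam_sorted); split=> c r c0 hr; have [r0 rz] := andP hr.
    by rewrite !e0 //; apply: cellP => //; rewrite r0 ltnW.
  rewrite !e0 //; first exact: cellP.
  by apply: cellP => //; rewrite r0 (leq_trans rz) // collen_anti.
rewrite (big_pred1 T0); last first.
  move=> T /=; apply/andP/eqP => [[sT]|->].
    rewrite key_le1 // => /allP H; apply/ffunP => c; apply: ord_inj; apply: succn_inj.
    by rewrite -!entry_cell (eqP (H _ (valP c))) e0 //; apply: valP.
  by split=> //; rewrite key_le1 //; apply/allP => c hc; rewrite e0.
apply: eq_bigr => t _; congr (_ ^+ _)%R; rewrite card_value //.
rewrite /bit_count /colseq /columns count_map.
have hrow : rowlen lam t.+1 <= L.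
  rewrite /rowlen /=; case: (tval lam) lam_sorted => [|x s]; first by rewrite nth_nil.
  case: (val t) => //= k srt.
  have [hk|hk] := ltnP k (size s); last by rewrite nth_default.
  have /(all_nthP 0)/(_ k hk)// : all (geq x) s.
  by apply: (order_path_min _ srt) => a b c /= h1 h2; apply: leq_trans h2 h1.
rewrite (eq_in_count (a2 := fun j => j <= rowlen lam t.+1)).
  rewrite (tnth_nth 0) -/(rowlen lam t.+1) /itv /index_iota subn1 /=.
  rewrite -[X in iota _ X](subnKC hrow) iotaD count_cat.
  rewrite (eq_in_count (a2 := predT)) ?count_predT ?size_iota; last first.
    by move=> j; rewrite mem_iota add1n ltnS => /andP[].
  rewrite (eq_in_count (a2 := pred0)) ?count_pred0 ?addn0 //.
  by move=> j; rewrite mem_iota add1n => /andP[+ _]; rewrite ltnNge => /negbTE.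
move=> j; rewrite mem_itv => /andP[j0 jL] /=.
rewrite nth_bits; last by have := ltn_ord t; lia.
have -> : n - (n.-1 - t) = t.+1 by have := ltn_ord t; lia.
rewrite -conjugateE //; apply/mem_coldown/idP => [[r hr]|h].
  by rewrite e0 ?cellP //= => ->; case/andP: hr.
by exists t.+1; rewrite ?h // e0 // cellP.
Qed.
End Base.

Lemma demazure_key_le n (lam : n.-tuple nat) (w : seq 'I_n.-1) (pi : 'S_n) :
  0 < n -> sorted geq lam -> reduced_composition pi w ->
  demazure lam w =
  (\sum_(T : filling n lam | semistandard T && key_le (key_bits lam pi) (colseq T))
     weight T)%R.
Proof.
move=> n0 srt; elim: w pi => [|i w IH] pi red.
  by case: (red) => <- _; apply: demazure_id.
have [red' lt_pi] := reduced_cons red; case: (red) => <- _.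
have red_sum g := sum_tabseqs n srt (key_le (key_bits lam g)).
rewrite /= (IH _ red') !red_sum key_bits_sact ?size_tuple //.
apply: (demazure_step (L := rowlen lam 1)).
- exact: tabseqs_uniq.
- move=> cs; rewrite mem_tabseqs // => /and3P[-> /eqP/(congr1 size)].
  by rewrite !size_map /itv /index_iota subn1 size_iota.
- by move=> cs; rewrite !mem_tabseqs //; apply: tabseq_flip_plus.
- by move=> cs; rewrite !mem_tabseqs //; apply: tabseq_flip_minus.
- by move=> l lL; rewrite nth_key_bits // size_bits.
- by move=> l lL; apply: key_bits_minus => //; apply: size_tuple.
- exact: size_key_bits.
Qed.

Theorem corollary10p2 (n : nat) (lam : n.-tuple nat) (pi : 'S_n)
    (w : seq 'I_n.-1)
    (hn : (0 < n)%N) (hlam : is_partition lam) (hpi : in_Sn_lam lam pi)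
    (hw : reduced_composition pi w) :
  demazure lam w =
    (\sum_(T : filling n lam | semistandard T && condA pi T) weight T)%R
  /\
  demazure lam w =
    (\sum_(T : filling n lam | semistandard T && condB pi T) weight T)%R.
Proof.
rewrite (demazure_key_le hn hlam hw); split; apply: eq_bigl => T.
  by apply: andb_id2l => sT; rewrite (condA_key_le hlam (size_tuple lam)).
by apply: andb_id2l => sT; rewrite (condB_key_le hlam (size_tuple lam)).
Qed.
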